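(* Let $n\ge2$ be an integer and let $q>n+2$ be a real number. Then there exist smooth strictly convex origin-symmetric bodies $K,L\subset\mathbb{R}^n$ such that $$\widetilde V_q(K+L)^{\frac1q}<\widetilde V_q(K)^{\frac1q}+\widetilde V_q(L)^{\frac1q}.$$
   Context: A convex body in $\mathbb{R}^n$ is a compact convex set with nonempty interior; it is origin-symmetric if $K=-K$. For a convex body $K$ with the origin in its interior, its radial function is $\rho_K(u)=\max\{\lambda>0:\lambda u\in K\}$, $u\in\mathbb{S}^{n-1}$, and for real $q$ the $q$-th dual quermassintegral is $$\widetilde V_q(K)=\frac1n\int_{\mathbb{S}^{n-1}}\rho_K(u)^q\,du,$$ where $du$ is spherical Lebesgue measure on the unit sphere. For $q>0$, equivalently $\widetilde V_q(K)=\frac qn\int_K|x|^{q-n}\,dx$. $K+L=\{x+y:x\in K,y\in L\}$ is the Minkowski sum. ''Smooth'' means with $C^\infty$ boundary. *)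

(* Defs.v *)
From HB Require Import structures.
From mathcomp Require Import all_boot all_order all_algebra.
From mathcomp Require Import all_classical all_reals all_analysis.
From mathcomp Require Import measurable_realfun.
Import Order.TTheory GRing.Theory Num.Theory numFieldNormedType.Exports.

Set Implicit Arguments.
Unset Strict Implicit.
Unset Printing Implicit Defensive.

Local Open Scope classical_set_scope.
Local Open Scope ring_scope.

Section rV_measurable.
Context {R : realType} (n : nat).

(* The product sigma-algebra on R^n; it is the Borel sigma-algebra. *)
Let rV_measurable : set (set 'rV[R]_n) :=
  g_sigma_preimage (fun (i : 'I_n) (x : 'rV[R]_n) => x 0 i : measurableTypeR R).

Let rV_measurable0 : rV_measurable set0.
Proof. exact: sigma_algebra0. Qed.

Let rV_measurableC A : rV_measurable A -> rV_measurable (~` A).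
Proof. exact: sigma_algebraC. Qed.

Let rV_measurable_bigcup (F : (set 'rV[R]_n)^nat) :
  (forall i, rV_measurable (F i)) -> rV_measurable (\bigcup_i F i).
Proof. exact: sigma_algebra_bigcup. Qed.

HB.instance Definition _ := @isMeasurable.Build default_measure_display
  'rV[R]_n rV_measurable rV_measurable0 rV_measurableC rV_measurable_bigcup.

Lemma measurable_coord (i : 'I_n) :
  measurable_fun setT (fun x : 'rV[R]_n => x 0 i : measurableTypeR R).
Proof.
move=> _ Y mY; rewrite setTI; apply: sub_sigma_algebra => /=.
rewrite -bigcup_seq/=; exists i => /=; first by rewrite mem_index_enum.
by exists Y => //; rewrite setTI.
Qed.

Lemma measurable_fun_rV d (T : measurableType d) (f : T -> 'rV[R]_n) :
  (forall i, measurable_fun setT (fun t => f t 0 i : measurableTypeR R)) ->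
  measurable_fun setT f.
Proof.
move=> mf _ A mA; rewrite setTI.
suff : measurable `<=` [set B | measurable (f @^-1` B)] by apply.
apply: smallest_sub.
  split; first by rewrite /= preimage_set0.
    by move=> B /= mB; rewrite setTD preimage_setC; exact: measurableC.
  by move=> F /= mF; rewrite preimage_bigcup; exact: bigcup_measurable.
rewrite -bigcup_seq => B [i _ [C mC <-]] /=; rewrite setTI.
by have := mf i measurableT _ mC; rewrite setTI.
Qed.

End rV_measurable.

Section lebesgue_rV.
Context {R : realType}.

Definition consrV n (p : measurableTypeR R * 'rV[R]_n) : 'rV[R]_n.+1 :=
  row_mx (p.1%:M : 'rV_1) p.2.

Definition unconsrV n (x : 'rV[R]_n.+1) : measurableTypeR R * 'rV[R]_n :=
  (x 0 ord0, \row_j x 0 (lift ord0 j)).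

Lemma measurable_consrV n : measurable_fun setT (@consrV n).
Proof.
apply: measurable_fun_rV => i; rewrite /consrV.
rewrite (_ : (fun _ => _) = (fun p : measurableTypeR R * 'rV[R]_n =>
  match @fintype.split 1 n i with inl _ => p.1 | inr j => p.2 0 j end)); last first.
  apply/funext => -[a x] /=; rewrite mxE; case: fintype.split => // j.
  by rewrite mxE (ord1 j) eqxx mulr1n.
case: fintype.split => [_|j]; first exact: measurable_fst.
exact: (measurableT_comp (measurable_coord j) measurable_snd).
Qed.

Lemma measurable_unconsrV n : measurable_fun setT (@unconsrV n).
Proof.
apply: measurable_fun_pair; first exact: measurable_coord.
apply: measurable_fun_rV => j.
rewrite (_ : (fun _ => _) = (fun x : 'rV[R]_n.+1 => x 0 (lift ord0 j))).
  exact: measurable_coord.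
by apply/funext => x; rewrite mxE.
Qed.

Lemma consrVK n : cancel (@consrV n) (@unconsrV n).
Proof.
move=> [a x]; congr pair => /=.
  transitivity (row_mx (a%:M : 'rV_1) x 0 (lshift n 0)).
    by congr (row_mx _ _ _ _); exact/val_inj.
  by rewrite row_mxEl mxE eqxx.
apply/rowP => j; rewrite mxE.
transitivity (row_mx (a%:M : 'rV_1) x 0 (rshift 1 j)).
  by congr (row_mx _ _ _ _); exact/val_inj.
by rewrite row_mxEr.
Qed.

Section step.
Variables (n : nat) (mu : {sigma_finite_measure set 'rV[R]_n -> \bar R}).

Definition mcons : set 'rV[R]_n.+1 -> \bar R :=
  pushforward (@lebesgue_measure R \x mu)%E (@consrV n).

Let mconsE : {measure set 'rV[R]_n.+1 -> \bar R} :=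
  measure_function_pushforward__canonical__measure_function_Measure
    (@lebesgue_measure R \x mu)%E (@measurable_consrV n).

HB.instance Definition _ := isMeasure.Build _ _ _ mcons
  (@measure0 _ _ _ mconsE) (@measure_ge0 _ _ _ mconsE)
  (@measure_semi_sigma_additive _ _ _ mconsE).

Let mcons_sigma_finite : sigma_finite setT mcons.
Proof.
have /sigma_finiteP[F [TF ndF Foo]] := sigma_finiteT (@lebesgue_measure R).
have /sigma_finiteP[G [TG ndG Goo]] := sigma_finiteT mu.
exists (fun k => @unconsrV n @^-1` (F k `*` G k)).
  rewrite -preimage_bigcup (_ : \bigcup_i _ = setT) ?preimage_setT//.
  apply/seteqP; split => // -[x y] _.
  have [k _ Fkx] : (\bigcup_i F i) x by rewrite -TF.
  have [l _ Gly] : (\bigcup_i G i) y by rewrite -TG.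
  exists (maxn k l) => //; split => /=.
    by move: x Fkx; exact/subsetPset/ndF/leq_maxl.
  by move: y Gly; exact/subsetPset/ndG/leq_maxr.
move=> k; have [mF Fk] := Foo k; have [mG Gk] := Goo k; split.
  have := @measurable_unconsrV n measurableT _ (measurableX mF mG).
  by rewrite setTI.
rewrite /mcons /pushforward -comp_preimage.
rewrite (_ : _ \o _ = id) ?preimage_id; last first.
  by apply/funext => p /=; rewrite consrVK.
by rewrite product_measure1E// lte_mul_pinfty// ge0_fin_numE.
Qed.

HB.instance Definition _ :=
  Measure_isSigmaFinite.Build _ _ _ mcons mcons_sigma_finite.

End step.

(* n-dimensional Lebesgue measure, as an iterated product measure. *)
Fixpoint lebesgue_rV (n : nat) : {sigma_finite_measure set 'rV[R]_n -> \bar R} :=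
  match n with
  | 0%N => @dirac _ 'rV[R]_0 0 R
  | m.+1 => mcons (lebesgue_rV m)
  end.

End lebesgue_rV.

Section sphere.
Context {R : realType} (n : nat).
Implicit Types (x u : 'rV[R]_n) (A : set 'rV[R]_n).

(* The norm that the library puts on row vectors is the sup norm. *)
Definition enorm x : R := Num.sqrt (\sum_(i < n) x 0 i ^+ 2).

Definition sphere : set 'rV[R]_n := [set u | enorm u = 1].

Definition cone A : set 'rV[R]_n :=
  [set x | exists r u, [/\ 0 < r, r <= 1, (A `&` sphere) u & x = r *: u]].

(* Spherical Lebesgue measure, characterised by: the cone over A with apex 0
   has volume sigma(A) / n. *)
Definition sphere_measure A : \bar R := (n%:R%:E * lebesgue_rV n (cone A))%E.

Lemma enormZ (r : R) x : enorm (r *: x) = `|r| * enorm x.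
Proof.
rewrite /enorm -sqrtr_sqr -sqrtrM ?sqr_ge0//; congr Num.sqrt.
by rewrite mulr_sumr; apply: eq_bigr => i _; rewrite mxE exprMn.
Qed.

Lemma measurable_enorm : measurable_fun setT enorm.
Proof.
apply: (@measurableT_comp _ _ _ _ _ _ (@Num.sqrt R)).
  by apply: continuous_measurable_fun; exact: sqrt_continuous.
apply: measurable_sum => i; apply: measurable_funX; exact: measurable_coord.
Qed.

Lemma measurable_normalize : measurable_fun setT (fun x => (enorm x)^-1 *: x).
Proof.
apply: measurable_fun_rV => i.
rewrite (_ : (fun _ => _) = (fun x => (enorm x `^ (-1)) * x 0 i)).
  apply: measurable_funM; last exact: measurable_coord.
  apply: (@measurableT_comp _ _ _ _ _ _ (@powR R ^~ (-1))).
    exact: measurable_powR.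
  exact: measurable_enorm.
by apply/funext => x; rewrite mxE powR_inv1// sqrtr_ge0.
Qed.

Lemma coneE A : cone A =
  (enorm @^-1` `]0, 1]) `&` ((fun x => (enorm x)^-1 *: x) @^-1` A).
Proof.
apply/seteqP; split => [x [r [u [r0 r1 [Au su] ->]]]|x] /=.
  have er : enorm (r *: u) = r by rewrite enormZ su mulr1 gtr0_norm.
  by rewrite er scalerA mulVf ?gt_eqF// scale1r in_itv/= r0 r1.
rewrite in_itv/= => -[/andP[x0 x1] Ax].
exists (enorm x), ((enorm x)^-1 *: x); split => //.
  split => //; rewrite /sphere /= enormZ gtr0_norm ?invr_gt0//.
  by rewrite mulVf ?gt_eqF.
by rewrite scalerA divff ?gt_eqF// scale1r.
Qed.

Lemma measurable_cone A : measurable A -> measurable (cone A).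
Proof.
move=> mA; rewrite coneE; apply: measurableI.
  by rewrite -[X in measurable X]setTI; exact: measurable_enorm.
by rewrite -[X in measurable X]setTI; exact: measurable_normalize.
Qed.

Let sphere_measure0 : sphere_measure set0 = 0%E.
Proof. by rewrite /sphere_measure coneE preimage_set0 setI0 measure0 mule0. Qed.

Let sphere_measure_ge0 A : (0 <= sphere_measure A)%E.
Proof. by rewrite /sphere_measure mule_ge0// lee_fin. Qed.

Let sphere_measure_sigma_additive : semi_sigma_additive sphere_measure.
Proof.
move=> F mF tF mUF; rewrite [X in X @ _ --> _](_ : _ =
    (fun k => n%:R%:E * \sum_(0 <= i < k) lebesgue_rV n (cone (F i)))%E); last first.
  by apply/funext => k; rewrite ge0_sume_distrr.
apply: cvgeZl => //.
have -> : cone (\bigcup_k F k) = \bigcup_k cone (F k).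
  by rewrite coneE preimage_bigcup setI_bigcupr; apply: eq_bigcupr => k _; rewrite coneE.
apply: measure_semi_sigma_additive.
- by move=> k; exact: measurable_cone.
- apply/trivIsetP => i j _ _ ij; move/trivIsetP : tF => /(_ i j I I ij) FF.
  rewrite !coneE setIACA [X in _ `&` X](_ : _ = set0) ?setI0//.
  by rewrite -preimage_setI FF preimage_set0.
- by apply: bigcup_measurable => k _; exact: measurable_cone.
Qed.

HB.instance Definition _ := isMeasure.Build _ _ _ sphere_measure
  sphere_measure0 sphere_measure_ge0 sphere_measure_sigma_additive.

End sphere.
Arguments sphere_measure {R} n A.
Arguments sphere {R} n _.

Section bodies.
Context {R : realType} (n : nat).
Implicit Types (K L U : set 'rV[R]_n) (g : 'rV[R]_n -> R).

Definition convex_body K :=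
  [/\ compact K, convex_set K & K° !=set0].

Definition origin_symmetric K := K = [set - x | x in K].

Definition strictly_convex K :=
  forall x y (t : R), K x -> K y -> x != y -> 0 < t < 1 ->
    K° (t *: x + (1 - t) *: y).

Definition minkowski_sum K L : set 'rV[R]_n :=
  [set x + y | x in K & y in L].

(* For a convex body with 0 in its interior the supremum is attained. *)
Definition radial K (u : 'rV[R]_n) : R := sup [set l : R | 0 < l /\ K (l *: u)].

Definition dual_quermassintegral (q : R) K : R :=
  n%:R^-1 * \int[sphere_measure n]_(u in sphere n) (radial K u `^ q).

Fixpoint Ck_on (k : nat) U g : Prop :=
  (forall x, U x -> {for x, continuous g}) /\
  match k with
  | 0%N => True
  | m.+1 => forall i : 'I_n,
      (forall x, U x -> derivable g x (delta_mx 0 i)) /\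
      Ck_on m U (fun x => 'D_(delta_mx 0 i) g x)
  end.

Definition smooth_on U g := forall k, Ck_on k U g.

(* Near each boundary point, K is the sublevel set of a C^oo function that is
   regular at that point. *)
Definition smooth_boundary K :=
  forall x, (closure K `\` K°) x -> exists U g,
    [/\ open U, U x, smooth_on U g,
        exists i : 'I_n, 'D_(delta_mx 0 i) g x != 0
      & K `&` U = [set y | U y /\ g y <= 0]].

End bodies.

(* Main.v *)
From HB Require Import structures.
Require Import Defs.
From mathcomp Require Import all_boot all_order perm all_algebra.
From mathcomp Require Import all_classical all_reals all_analysis.
From mathcomp Require Import measurable_realfun.
From mathcomp Require Import ring lra.
Import Order.TTheory GRing.Theory Num.Theory numFieldNormedType.Exports.
Set Implicit Arguments.
Unset Strict Implicit.
Unset Printing Implicit Defensive.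
Local Open Scope classical_set_scope.
Local Open Scope ring_scope.

(** Put p = q - n > 2. If g is the gauge of K, then V~_q(K) is the integral of
    (|x| / g(x))^p over K. For the box with half-sides d the substitution
    x = (d_i y_i) turns this into the integral over the unit cube of
    (sum_i d_i^2 y_i^2)^(p/2) |y|_oo^(-p), times prod_i d_i. Denote it by V(d).

    Compare d = (1 + e, 1 - e, c, ..., c), its mirror image d' under the swap of
    the first two coordinates, and their midpoint (1, 1, c, ..., c). Swapping
    y_0 and y_1 and convexity of s^(p/2) give
      V(d) = V(d') >= c^(n-2) (1 - e^2) (1 + e^2)^(p/2) E,
    where E is the integral for (1, 1, 0, ..., 0) without the factor prod_i d_i,
    whereas V(1, 1, c, ..., c) is c^(n-2) (E + o(1)) as c -> 0. Since p > 2,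
    (1 - e^2) (1 + e^2)^(p/2) > 1 for small e, so for small c the midpoint box
    has the smaller V. Finally the two boxes are approximated from inside by
    superellipsoids with a large exponent. *)

(** * Dilations of Lebesgue measure on the line *)

Section lebesgue_integral_scaling.
Context {R : realType}.
Local Open Scope ereal_scope.
Local Notation mu := (@lebesgue_measure R).

(** As a function of [A] the right-hand side is a rescaled pushforward measure; it agrees with [mu]
    on half-open intervals, and these determine the measure. *)
Lemma lebesgue_measure_scale (a : R) (A : set (measurableTypeR R)) :
  (0 < a)%R -> measurable A ->
  mu A = a%:E * mu ((fun x => a * x)%R @^-1` A).
Proof.
move=> a0 mA.
have ma : measurable_fun setT (fun x : measurableTypeR R => (a * x)%R :
  measurableTypeR R).
  by apply: measurable_funM => //; exact: measurable_cst.
pose nu : {measure set (measurableTypeR R) -> \bar R} :=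
  measure_function_pushforward__canonical__measure_function_Measure mu ma.
pose m : {measure set (measurableTypeR R) -> \bar R} :=
  mscale (NngNum (ltW a0)) nu.
have -> : a%:E * mu ((fun x => a * x)%R @^-1` A) = m A by [].
apply: lebesgue_measure_unique => // _ [[x y] /= xy <-].
rewrite /m /mscale/= /nu/= /pushforward.
have -> : (fun z => a * z)%R @^-1` `]x, y] = `](x / a)%R, (y / a)%R]%classic.
  apply/seteqP; split=> z /=; rewrite !in_itv/= ltr_pdivrMr// ler_pdivlMr//;
  by rewrite !(mulrC a).
rewrite !lebesgue_measure_itv/= !lte_fin ltr_pM2r ?invr_gt0//.
case: ifPn => [_|]; last by rewrite mule0.
by rewrite -!EFinD -EFinM -mulrBl mulrCA divff ?mulr1// gt_eqF.
Qed.

Lemma ge0_integral_scale (a : R) (f : R -> \bar R) :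
  (0 < a)%R -> measurable_fun setT f -> (forall x, 0 <= f x) ->
  \int[mu]_x f x = a%:E * \int[mu]_x f (a * x)%R.
Proof.
move=> a0 mf f0.
have ma : measurable_fun setT (fun x : measurableTypeR R => (a * x)%R :
  measurableTypeR R).
  by apply: measurable_funM => //; exact: measurable_cst.
pose nu : {measure set (measurableTypeR R) -> \bar R} :=
  measure_function_pushforward__canonical__measure_function_Measure mu ma.
rewrite (eq_measure_integral (mscale (NngNum (ltW a0)) nu)); last first.
  by move=> A mA _; exact: lebesgue_measure_scale.
rewrite ge0_integral_mscale//=; congr (_ * _).
by rewrite ge0_integral_pushforward.
Qed.

End lebesgue_integral_scaling.

(** * Iterated integrals in R^n: diagonal substitutions and exchange of two coordinates *)

Section lebesgue_rV_integral.
Context {R : realType}.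
Local Open Scope ereal_scope.
Local Notation leb := (@lebesgue_rV R).

Lemma consrV0 n (p : measurableTypeR R * 'rV[R]_n) : consrV p 0%R ord0 = p.1.
Proof. by have := congr1 fst (consrVK p). Qed.

Lemma consrVS n (p : measurableTypeR R * 'rV[R]_n) j :
  consrV p 0%R (lift ord0 j) = p.2 0%R j.
Proof.
by have := congr1 (fun q : measurableTypeR R * 'rV[R]_n => q.2 0%R j) (consrVK
  p); rewrite /= mxE.
Qed.

(** By construction [lebesgue_rV n.+1] is the pushforward of a product measure under [consrV], so
    this is Tonelli's theorem. *)
Lemma ge0_integral_consrV n (f : 'rV[R]_n.+1 -> \bar R) :
  measurable_fun setT f -> (forall x, 0 <= f x) ->
  \int[leb n.+1]_x f x =
  \int[@lebesgue_measure R]_a \int[leb n]_y f (consrV (a, y)).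
Proof.
move=> mf f0.
pose m : {measure set 'rV[R]_n.+1 -> \bar R} :=
  measure_function_pushforward__canonical__measure_function_Measure
    (@lebesgue_measure R \x leb n) (@measurable_consrV R n).
rewrite (eq_measure_integral m); last by [].
rewrite ge0_integral_pushforward//; last exact: measurable_consrV.
rewrite preimage_setT fubini_tonelli1//=.
exact: measurableT_comp mf (@measurable_consrV R n).
Qed.

Lemma measurable_integral_consrV n (f : 'rV[R]_n.+1 -> \bar R) :
  measurable_fun setT f -> (forall x, 0 <= f x) ->
  measurable_fun setT (fun a : measurableTypeR R => \int[leb n]_y f (consrV (a,
    y))).
Proof.
move=> mf f0.
have mfc : measurable_fun setT (f \o @consrV R n).
  exact: measurableT_comp mf (@measurable_consrV R n).
exact (@measurable_fun_fubini_tonelli_F _ _ _ _ R (leb n) _ mfc (fun p => f0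
  (consrV p))).
Qed.

Lemma measurable_consrV_pair n a : measurable_fun setT (fun y : 'rV[R]_n =>
  consrV (a, y)).
Proof.
exact: measurableT_comp (@measurable_consrV R n) (pair1_measurable a).
Qed.

Definition rowmul n (d x : 'rV[R]_n) : 'rV[R]_n := \row_i (d 0 i * x 0 i)%R.

Lemma measurable_rowmul n (d : 'rV[R]_n) : measurable_fun setT (rowmul d).
Proof.
apply: measurable_fun_rV => i; rewrite /rowmul.
rewrite (_ : (fun _ => _) = (fun t : 'rV[R]_n => d 0 i * t 0 i)%R).
  by apply: measurable_funM => //; exact: measurable_coord.
by apply/funext => t; rewrite mxE.
Qed.

(** Induction on the dimension: one-dimensional scaling handles the outer integral, the induction
    hypothesis with the remaining factors [d'] the inner one. *)
Lemma ge0_integral_rowmul n (d : 'rV[R]_n) (f : 'rV[R]_n -> \bar R) :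
  (forall i, 0 < d 0 i)%R ->
  measurable_fun setT f -> (forall x, 0 <= f x) ->
  \int[leb n]_x f x = (\prod_i d 0 i)%R%:E * \int[leb n]_x f (rowmul d x).
Proof.
elim: n d f => [d f _ mf f0|n IH d f d0 mf f0].
  rewrite big_ord0 mul1e; apply: eq_integral => x _; congr f.
  by apply/rowP => -[].
pose d' := \row_j d 0%R (lift ord0 j).
have rE a y : rowmul d (consrV (a, y)) = consrV ((d 0 ord0 * a)%R, rowmul d' y).
  apply/rowP => i; rewrite [LHS]mxE; case: (unliftP ord0 i) => [j|] ->.
    by rewrite !consrVS/= !mxE.
  by rewrite !consrV0.
have mfd : measurable_fun setT (f \o rowmul d) by apply: measurableT_comp mf
  (measurable_rowmul _).
rewrite ge0_integral_consrV// [in RHS]ge0_integral_consrV//.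
rewrite (@ge0_integral_scale _ (d 0%R ord0)) ?d0//; first last.
- by move=> x; apply: integral_ge0 => y _; exact: f0.
- exact: measurable_integral_consrV.
rewrite big_ord_recl EFinM -muleA; congr (_ * _).
have p0 : (0 <= \prod_(i < n) d ord0 (lift ord0 i))%R.
  by apply: prodr_ge0 => i _; exact/ltW/d0.
rewrite -ge0_integralZl_EFin//; first last.
- exact: (measurable_integral_consrV mfd (fun y => f0 _)).
- by move=> x _; apply: integral_ge0 => y _; exact: f0.
apply: eq_integral => a _ /=.
rewrite (IH d').
- congr (_ * _); first by congr (_ %:E); apply: eq_bigr => i _; rewrite mxE.
  by apply: eq_integral => y _; rewrite rE.
- by move=> i; rewrite mxE; exact: d0.
- exact: measurableT_comp mf (measurable_consrV_pair _).
- by move=> x; exact: f0.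
Qed.

Definition rowswap n (x : 'rV[R]_n.+2) : 'rV[R]_n.+2 :=
  \row_i x 0%R (tperm ord0 (lift ord0 ord0) i).

Lemma measurable_rowswap n : measurable_fun setT (@rowswap n).
Proof.
apply: measurable_fun_rV => i; rewrite /rowswap.
rewrite (_ : (fun _ => _) = (fun t : 'rV[R]_n.+2 => t 0 (tperm ord0 (lift ord0
  ord0) i))%R).
  exact: measurable_coord.
by apply/funext => t; rewrite mxE.
Qed.

Lemma rowswap_consrV n a b (z : 'rV[R]_n) :
  rowswap (consrV (a, consrV (b, z))) = consrV (b, consrV (a, z)).
Proof.
apply/rowP => i; rewrite mxE.
case: (unliftP ord0 i) => [j|] ->; last by rewrite tpermL consrVS !consrV0.
case: (unliftP ord0 j) => [k|] ->.
  by rewrite tpermD// !consrVS.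
by rewrite tpermR consrVS !consrV0.
Qed.

(** With all other coordinates integrated out into [F], the swap exchanges the two outermost
    integrals, and Tonelli applies to [F]. *)
Lemma ge0_integral_rowswap n (f : 'rV[R]_n.+2 -> \bar R) :
  measurable_fun setT f -> (forall x, 0 <= f x) ->
  \int[leb n.+2]_x f (rowswap x) = \int[leb n.+2]_x f x.
Proof.
move=> mf f0.
have mfs : measurable_fun setT (f \o @rowswap n) by exact: measurableT_comp mf
  (@measurable_rowswap n).
pose F (p : measurableTypeR R * measurableTypeR R) :=
  \int[leb n]_z f (consrV (p.1, consrV (p.2, z))).
have F0 p : 0 <= F p by apply: integral_ge0.
have mF : measurable_fun setT F.
  have mf3 : measurable_fun setT
      (fun p : (measurableTypeR R * measurableTypeR R) * 'rV[R]_n =>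
       f (consrV (p.1.1, consrV (p.1.2, p.2)))).
    apply: measurableT_comp mf _; apply: measurableT_comp (@measurable_consrV R
      n.+1) _.
    apply: measurable_fun_pair; first exact: measurableT_comp measurable_fst
      measurable_fst.
    apply: measurableT_comp (@measurable_consrV R n) _.
    by apply: measurable_fun_pair => //;
      exact: measurableT_comp measurable_snd measurable_fst.
  exact (@measurable_fun_fubini_tonelli_F _ _ _ _ R (leb n) _ mf3 (fun p => f0
    _)).
rewrite ge0_integral_consrV// [RHS]ge0_integral_consrV//.
transitivity (\int[@lebesgue_measure R]_a \int[@lebesgue_measure R]_b F (b, a)).
  apply: eq_integral => a _; rewrite ge0_integral_consrV//; last first.
    exact: measurableT_comp mfs (measurable_consrV_pair _).
  apply: eq_integral => b _; apply: eq_integral => z _.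
  by rewrite rowswap_consrV.
rewrite -(fubini_tonelli F)//.
apply: eq_integral => a _; rewrite ge0_integral_consrV//.
exact: measurableT_comp mf (measurable_consrV_pair _).
Qed.

End lebesgue_rV_integral.

(** * Measurability of real-valued expressions *)

Section measurability.
Context d (T : measurableType d) {R : realType}.
Implicit Types (f g : T -> R).

Lemma measurable_fun_natr (b : T -> bool) :
  measurable_fun setT b -> measurable_fun setT (fun x => (b x)%:R : R).
Proof.
move=> mb.
by apply: (@measurableT_comp _ _ _ _ _ _ (fun c : bool => c%:R : R)).
Qed.

Lemma measurable_fun_lerR f g : measurable_fun setT f ->
  measurable_fun setT g ->
  measurable_fun setT (fun x => (f x <= g x)%R%:R : R).
Proof.
by move=> mf mg; apply: measurable_fun_natr;
  exact: measurable_fun_ler.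
Qed.

Lemma measurable_fun_ltrR f g : measurable_fun setT f ->
  measurable_fun setT g ->
  measurable_fun setT (fun x => (f x < g x)%R%:R : R).
Proof.
by move=> mf mg; apply: measurable_fun_natr;
  exact: measurable_fun_ltr.
Qed.

Lemma measurable_fun_powR f p : measurable_fun setT f ->
  measurable_fun setT (fun x => f x `^ p).
Proof. by move=> mf; apply: (measurableT_comp (measurable_powR _)). Qed.

Lemma measurable_fun_inv f : (forall x, 0 <= f x) -> measurable_fun setT f ->
  measurable_fun setT (fun x => (f x)^-1).
Proof.
move=> f0 mf; rewrite (_ : (fun _ => _) = fun x => f x `^ (-1)).
  exact: measurable_fun_powR.
by apply/funext => x; rewrite powR_inv1.
Qed.

End measurability.

Ltac meas :=
  repeat first
    [ assumption
    | exact: measurable_cst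
    | exact: measurable_id
    | exact: measurable_fst
    | exact: measurable_snd
    | apply: measurable_fun_lerR
    | apply: measurable_fun_ltrR
    | apply: measurable_funM
    | apply: measurable_funD
    | apply: measurable_funX
    | apply: measurable_fun_powR ].

(** * Gauges of star-shaped sets and the passage from one gauge to another *)

Section homogeneous.
Context {R : realType} (n : nat).
Local Notation leb := (@lebesgue_rV R).
Implicit Types (g N psi : 'rV[R]_n.+1 -> R).

(** The Minkowski functional of the star-shaped set [g x <= 1]. The Euclidean norm and the box
    gauges are the two instances compared below. *)
Record gauge g : Prop := Gauge {
  gauge_measurable : measurable_fun setT g ;
  gauge_gt0 : forall x, x != 0 -> 0 < g x ;
  gaugeZ : forall s x, 0 < s -> g (s *: x) = s * g x }.

Lemma gauge0 g : gauge g -> g 0 = 0.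
Proof.
move=> gg; have := gaugeZ gg 0 (ltr0n R 2); rewrite scaler0 => /eqP.
by rewrite -subr_eq0 -{1}(mul1r (g 0)) -mulrBl mulf_eq0 => /orP[|/eqP//]; lra.
Qed.

Lemma gauge_ge0 g x : gauge g -> 0 <= g x.
Proof.
move=> gg; have [->|x0] := eqVneq x 0; first by rewrite gauge0.
exact/ltW/gauge_gt0.
Qed.

Lemma gauge_eq0 g x : gauge g -> (g x == 0) = (x == 0).
Proof.
move=> gg; have [->|x0] := eqVneq x 0; first by rewrite gauge0// eqxx.
by rewrite gt_eqF// gauge_gt0.
Qed.

(** The radial integral, equal to 1/(n+1). What counts is that it depends on no gauge, so that it is
    the same on both sides when two gauges are compared. *)
Let c : \bar R :=
  (\int[@lebesgue_measure R]_s (s ^+ n * ((0 < s)%R%:R * (s <= 1)%R%:R))%:E)%E.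

Lemma rowmul_const s (y : 'rV[R]_n.+1) : rowmul (const_mx s) y = s *: y.
Proof. by apply/rowP => i; rewrite !mxE. Qed.

Lemma measurable_snd_comp d (T : measurableType d) (f : T -> R) :
  measurable_fun setT f -> measurable_fun setT (fun p : measurableTypeR R * T
    => f p.2).
Proof. by move=> mf; exact: measurableT_comp mf measurable_snd. Qed.

(* Both sides are the integral of [psi x / N x] over the pairs (s, x) with
   0 < s <= N x and g x <= 1, the right one after x = s y and s = t / g y. *)
Lemma integral_gauge_le1 g N psi : gauge g -> gauge N ->
  measurable_fun setT psi -> (forall x, 0 <= psi x) -> psi 0 = 0 ->
  (forall s x, 0 < s -> psi (s *: x) = psi x) ->
  (\int[leb n.+1]_x (psi x * (g x <= 1)%R%:R)%:E =
   \int[leb n.+1]_x ((psi x * (N x)^-1 * (1 <= N x)%R%:R * (g x)^-1 ^+ n.+1)%:E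
     * c))%E.
Proof.
move=> gg gN mpsi psi0 psi00 psiZ.
have mg := gauge_measurable gg; have mN := gauge_measurable gN.
have N0 x := gauge_ge0 x gN; have g0 x := gauge_ge0 x gg.
have mNV : measurable_fun setT (fun x => (N x)^-1) by exact: measurable_fun_inv.
have c0 (a s : R) : 0 <= s ^+ n * ((0 < s)%R%:R * (s * a <= 1)%R%:R).
  have [s0|_] := ltP 0 s; last by rewrite mul0r mulr0.
  by rewrite mulr_ge0 ?mulr_ge0// exprn_ge0// ltW.
(* The substitution x = s y at fixed s: the Jacobian is s^(n+1), the factor 1/N takes away one power
   of s, and s <= N (s y) becomes 1 <= N y. *)
have key (s : R) x : 0 < s ->
    s ^+ n.+1 * (psi (s *: x) * (N (s *: x))^-1 * (g (s *: x) <= 1)%R%:R *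
      ((0 < s)%R%:R * (s <= N (s *: x))%R%:R)) =
    psi x * (N x)^-1 * (1 <= N x)%R%:R *
      (s ^+ n * ((0 < s)%R%:R * (s * g x <= 1)%R%:R)).
  move=> s0; rewrite psiZ// (gaugeZ gg)// (gaugeZ gN)// ler_pMr//
    s0 invfM exprS.
  transitivity ((s * s^-1) * (psi x * (N x)^-1 * (1 <= N x)%R%:R *
      (s ^+ n * (true%:R * (s * g x <= 1)%R%:R)))); first by ring.
  by rewrite divff ?mul1r// gt_eqF.
pose H (p : measurableTypeR R * 'rV[R]_n.+1) : \bar R :=
  (psi p.2 * (N p.2)^-1 * (g p.2 <= 1)%R%:R * ((0 < p.1)%R%:R * (p.1 <= N
    p.2)%R%:R))%:E.
have H0 p : (0 <= H p)%E.
  by rewrite lee_fin !mulr_ge0 ?invr_ge0.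
have m1 : measurable_fun setT (fst : measurableTypeR R * 'rV[R]_n.+1 -> R) :=
  measurable_fst.
have mH : measurable_fun setT H.
  apply/measurable_EFinP.
  have := measurable_snd_comp mpsi; have := measurable_snd_comp mNV.
  have := measurable_snd_comp mg; have := measurable_snd_comp mN.
  by move=> ? ? ? ?; meas.
pose H2 (p : measurableTypeR R * 'rV[R]_n.+1) : \bar R :=
  (psi p.2 * (N p.2)^-1 * (1 <= N p.2)%R%:R *
    (p.1 ^+ n * ((0 < p.1)%R%:R * (p.1 * g p.2 <= 1)%R%:R)))%:E.
have H20 p : (0 <= H2 p)%E.
  rewrite lee_fin; apply: mulr_ge0; first by rewrite !mulr_ge0 ?invr_ge0.
  exact: c0.
have mH2 : measurable_fun setT H2.
  apply/measurable_EFinP.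
  have := measurable_snd_comp mpsi; have := measurable_snd_comp mNV.
  have := measurable_snd_comp mg; have := measurable_snd_comp mN.
  by move=> ? ? ? ?; meas.
(* The length of the interval from 0 to [N x] cancels the factor 1/N; at the origin, where it
   cannot, [psi] vanishes. *)
transitivity (\int[leb n.+1]_x \int[@lebesgue_measure R]_s H (s, x))%E.
  apply: eq_integral => x _.
  rewrite [RHS](_ : _ = \int[@lebesgue_measure R]_s
     ((psi x * (N x)^-1 * (g x <= 1)%R%:R)%:E * (\1_(`]0,
       N x]%classic) s)%:E))%E; last first.
    apply: eq_integral => s _; rewrite /H /= -EFinM; congr (_ * _)%:E.
    by rewrite indicE mem_setE in_itv/= -natrM mulnb.
  rewrite ge0_integralZl_EFin//; last 2 first.
  - by apply/measurable_EFinP; exact: measurable_indic.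
  - by rewrite !mulr_ge0 ?invr_ge0.
  rewrite integral_indic//= setIT lebesgue_measure_itv/= lte_fin.
  have [->|x0] := eqVneq x 0; first by rewrite psi00 !mul0r mul0e.
  have Nx := gauge_gt0 gN x0.
  rewrite Nx sube0 -EFinM mulrAC mulrVK//; first by rewrite unitfE gt_eqF.
rewrite -(fubini_tonelli H)//.
transitivity (\int[@lebesgue_measure R]_s \int[leb n.+1]_x H2 (s, x))%E.
  apply: eq_integral => s _; have [s0|s0] := ltP 0 s; last first.
    rewrite !integral0_eq// => x _; rewrite /H /H2/= ltNge s0/= ?mul0r ?mulr0//.
  have sV : s^-1 != 0 by rewrite invr_eq0 gt_eqF.
  rewrite [LHS](@ge0_integral_rowmul _ _ (const_mx s))//; last 2 first.
  - by move=> i; rewrite mxE.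
  - exact: (measurableT_comp mH (pair1_measurable s)).
  rewrite -ge0_integralZl_EFin//; last 2 first.
  - apply: (measurableT_comp (measurableT_comp mH (pair1_measurable s))).
    exact: measurable_rowmul.
  - by apply: prodr_ge0 => i _; rewrite mxE ltW.
  apply: eq_integral => x _; rewrite rowmul_const /H /H2/= -EFinM -(key s x s0).
  by under eq_bigr do rewrite mxE; rewrite prodr_const card_ord.
rewrite (fubini_tonelli H2)//.
apply: eq_integral => x _; rewrite /H2/=.
have [->|x0] := eqVneq x 0.
  by rewrite psi00 !mul0r mul0e integral0_eq// => s _; rewrite !mul0r.
have gx := gauge_gt0 gg x0.
(* Rescaling s by 1/g gives n powers of 1/g here and one more from the Jacobian, hence the exponent
   n+1 in the statement. *)
have key2 (s : R) : ((g x)^-1 * s) ^+ n *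
    ((0 < (g x)^-1 * s)%R%:R * ((g x)^-1 * s * g x <= 1)%R%:R) =
    (g x)^-1 ^+ n * (s ^+ n * ((0 < s)%R%:R * (s <= 1)%R%:R)).
  have -> : (g x)^-1 * s * g x = s by rewrite mulrAC mulVf ?mul1r// gt_eqF.
  by rewrite exprMn pmulr_rgt0 ?invr_gt0// -mulrA.
have mc : measurable_fun setT (fun s : R => s ^+ n * ((0 < s)%R%:R * (s <=
  1)%R%:R)).
  by meas.
have mcg : measurable_fun setT (fun s : R => s ^+ n * ((0 < s)%R%:R * (s * g x
  <= 1)%R%:R)).
  by meas.
under eq_integral do rewrite EFinM.
rewrite ge0_integralZl_EFin//; last 3 first.
- by move=> s _; rewrite lee_fin.
- exact/measurable_EFinP.
- by rewrite !mulr_ge0 ?invr_ge0.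
rewrite [in RHS]EFinM -muleA;congr (_ * _)%E.
rewrite (@ge0_integral_scale _ (g x)^-1) ?invr_gt0//; last 2 first.
- exact/measurable_EFinP.
- by move=> s; rewrite lee_fin.
rewrite exprS EFinM -muleA; congr (_ * _)%E.
rewrite -ge0_integralZl_EFin//; last 3 first.
- by move=> s _; have := c0 1 s; rewrite mulr1 lee_fin.
- exact/measurable_EFinP.
- by rewrite exprn_ge0 ?invr_ge0.
apply: eq_integral => s _; rewrite -EFinM; congr (_%:E).
exact: key2.
Qed.

(** Both sides are brought to the form of [integral_gauge_le1]: the left one with the gauge [g], the
    right one with the gauge [N] and the weight [psi * (N / g) ^+ n.+1], again homogeneous of degree
    0. The powers of [N] then cancel. *)
Lemma integral_gauge_change g N psi : gauge g -> gauge N ->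
  measurable_fun setT psi -> (forall x, 0 <= psi x) -> psi 0 = 0 ->
  (forall s x, 0 < s -> psi (s *: x) = psi x) ->
  (\int[leb n.+1]_x (psi x * (g x <= 1)%R%:R)%:E =
   \int[leb n.+1]_x (psi x * (N x / g x) ^+ n.+1 * (N x <= 1)%R%:R)%:E)%E.
Proof.
move=> gg gN mpsi psi0 psi00 psiZ.
have mgV : measurable_fun setT (fun x => (g x)^-1).
  by apply: measurable_fun_inv => [x|];
    [exact: gauge_ge0 | exact: gauge_measurable].
rewrite (integral_gauge_le1 gg gN)//
  (integral_gauge_le1 gN gN (psi := fun x => psi x * (N x / g x) ^+ n.+1)).
- apply: eq_integral => x _; congr ((_)%:E * _)%E.
  have [->|x0] := eqVneq x 0; first by rewrite psi00 !mul0r.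
  have Nx : N x != 0 by rewrite gauge_eq0.
  rewrite expr_div_n -!exprVn.
  transitivity (psi x * (N x)^-1 * (1 <= N x)%R%:R * (g x)^-1 ^+ n.+1 *
      (N x ^+ n.+1 * (N x)^-1 ^+ n.+1)).
    by rewrite -exprMn divff// expr1n mulr1.
  by ring.
- by have mN := gauge_measurable gN; meas.
- by move=> x; rewrite mulr_ge0// exprn_ge0// divr_ge0// gauge_ge0.
- by rewrite psi00 mul0r.
- move=> s x s0; rewrite psiZ// (gaugeZ gg)// (gaugeZ gN)//
  invfM mulrACA divff ?mul1r//.
  by rewrite gt_eqF.
Qed.

End homogeneous.

(** * Comparison of integrals and restriction of measures *)

Section integral_extra.
Context d (T : measurableType d) {R : realType}.
Local Open Scope ereal_scope.

(* Applied to radial functions, whose measurability is never established. *)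
Lemma ge0_le_integral_nonmeasurable (mu : {measure set T -> \bar R}) D
    (f g : T -> \bar R) :
  (forall x, D x -> 0 <= f x) -> (forall x, D x -> f x <= g x) ->
  \int[mu]_(x in D) f x <= \int[mu]_(x in D) g x.
Proof.
move=> f0 fg.
have g0 x : D x -> 0 <= g x by move=> Dx; rewrite (le_trans (f0 _ Dx)) ?fg.
rewrite !ge0_integralE//; apply: ge_ereal_sup => _ [h /= hf <-].
apply: ereal_sup_ubound; exists h => //= x; rewrite (le_trans (hf x))//.
by rewrite /patch; case: ifPn => //; rewrite inE => /fg.
Qed.

Lemma ge0_integral_mrestr (mu : {measure set T -> \bar R}) D
    (mD : measurable D) f :
  measurable_fun setT f -> (forall x, 0 <= f x) ->
  \int[mrestr mu mD]_x f x = \int[mu]_(x in D) f x.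
Proof.
move=> mf f0; have mCD : measurable (~` D) by exact: measurableC.
rewrite -(setUv D) ge0_integral_setU//; last 2 first.
- by rewrite setUv.
- by apply/disj_setPS; rewrite setICr.
rewrite [X in _ + X](_ : _ = 0) ?adde0; last first.
  apply: null_set_integral => //; first exact: measurable_funTS.
  by rewrite /= /mrestr setICl measure0.
apply: eq_measure_integral => A mA AD.
by rewrite /= /mrestr; congr (mu _); apply/setIidPl.
Qed.

End integral_extra.

(** * Polar coordinates *)

Section sphere_integral.
Context {R : realType} (n : nat).
Local Notation leb := (@lebesgue_rV R).

Lemma gauge_enorm : gauge (@enorm R n.+1).
Proof.
split; first exact: measurable_enorm.
  move=> x x0; rewrite lt_neqAle sqrtr_ge0 andbT eq_sym; apply: contra x0.
  rewrite sqrtr_eq0 => s0; apply/eqP/rowP => i; rewrite mxE; apply/eqP.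
  rewrite -sqrf_eq0 eq_le sqr_ge0 andbT (le_trans _ s0)//.
  rewrite (bigD1 i)//= lerDl; apply: sumr_ge0 => j _; exact: sqr_ge0.
by move=> s x s0; rewrite enormZ gtr0_norm.
Qed.

Lemma measurable_sphere : measurable (@sphere R n.+1).
Proof.
rewrite -[X in measurable X]setTI; have := @measurable_enorm R n.+1.
by move=> /(_ measurableT [set 1] (measurable_set1 _)).
Qed.

(** By [coneE], the spherical measure is n+1 times the pushforward, under x -> x/|x|, of Lebesgue
    measure restricted to the punctured unit ball. *)
Lemma integral_sphere (h : 'rV[R]_n.+1 -> \bar R) :
  measurable_fun setT h -> (forall x, 0 <= h x)%E ->
  (\int[sphere_measure n.+1]_(u in sphere n.+1) h u =
   n.+1%:R%:E * \int[leb n.+1]_(x in @enorm R n.+1 @^-1` `]0%R, 1%R])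
                  h ((enorm x)^-1 *: x))%E.
Proof.
move=> mh h0; set D := _ @^-1` _.
have mS := measurable_sphere.
have mD : measurable D.
  by rewrite -[X in measurable X]setTI; apply: measurable_enorm.
have mnu := @measurable_normalize R n.+1.
pose nu : {measure set 'rV[R]_n.+1 -> \bar R} :=
  measure_function_pushforward__canonical__measure_function_Measure
    (mrestr (leb n.+1) mD) mnu.
pose k : {nonneg R} := NngNum (ler0n R n.+1).
have mhS : measurable_fun setT (h \_ (@sphere R n.+1)).
  apply/(measurable_restrictT _ mS); exact: measurable_funTS.
have hS0 x : (0 <= (h \_ (@sphere R n.+1)) x)%E by apply: erestrict_ge0.
rewrite integral_mkcond (eq_measure_integral (mscale k nu)); last first.
  move=> A mA _; rewrite /mscale/= /nu/= /pushforward/= /mrestr/=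
    /sphere_measure.
  by rewrite coneE setIC.
rewrite (ge0_integral_mscale _ measurableT k mhS (fun x _ => hS0 x)).
congr (_ * _)%E.
rewrite (ge0_integral_pushforward mnu _ measurableT mhS (fun x _ => hS0 x)).
rewrite preimage_setT.
rewrite (ge0_integral_mrestr _ mD (measurableT_comp mhS mnu) (fun x => hS0 _)).
apply: eq_integral => x; rewrite inE /D/= in_itv/= => /andP[x0 _].
rewrite patchE ifT// inE /sphere/= enormZ gtr0_norm ?invr_gt0// mulVf//.
by rewrite gt_eqF.
Qed.

(** Change of gauge from [g] to the Euclidean norm with weight (|x|/g)^(q-n-1): the extra factor
    (|x|/g)^(n+1) completes the exponent to q, and |x|/g(x) is the inverse of g(x/|x|). *)
Lemma integral_sphere_gauge (g : 'rV[R]_n.+1 -> R) (q : R) : gauge g ->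
  n.+1%:R < q ->
  (\int[sphere_measure n.+1]_(u in sphere n.+1) ((g u)^-1 `^ q)%:E =
   n.+1%:R%:E * \int[leb n.+1]_x
     ((enorm x / g x) `^ (q - n.+1%:R) * (g x <= 1)%R%:R)%:E)%E.
Proof.
move=> gg nq; have gN := gauge_enorm.
have mg := gauge_measurable gg; have mN := gauge_measurable gN.
have mgV : measurable_fun setT (fun x => (g x)^-1).
  by apply: measurable_fun_inv => // x; exact: gauge_ge0.
(* The weight has to vanish at the origin, and the power of 0 is 0 only for a nonzero exponent. *)
have qn0 : q - n.+1%:R != 0 by rewrite gt_eqF// subr_gt0.
have q0 : q != 0 by rewrite gt_eqF// (le_lt_trans _ nq).
rewrite integral_sphere//; last 2 first.
- by apply/measurable_EFinP; meas.
- by move=> x; rewrite lee_fin powR_ge0.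
congr (_ * _)%E.
rewrite [RHS](integral_gauge_change (psi :=
  fun x => (enorm x / g x) `^ (q - n.+1%:R)) gg gN).
- rewrite integral_mkcond; apply: eq_integral => x _; rewrite patchE.
  have [->|x0] := eqVneq x 0.
    rewrite (gauge0 gN) mul0r powR0// !mul0r; case: ifPn => //.
    by rewrite inE/= (gauge0 gN) in_itv/= ltxx.
  have Nx := gauge_gt0 gN x0; have gx := gauge_gt0 gg x0.
  have -> : (x \in @enorm R n.+1 @^-1` `]0, 1]) = (enorm x <= 1).
    by apply/idP/idP; rewrite inE/= in_itv/= Nx.
  case: ifPn => xN; rewrite ?mulr1 ?mulr0//.
  rewrite (gaugeZ gg) ?invr_gt0// invfM invrK; congr (_%:E).
  rewrite -powR_mulrn ?divr_ge0 ?ltW// -powRD ?subrK//.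
  by rewrite (negbTE q0).
- by meas.
- by move=> x; exact: powR_ge0.
- by rewrite (gauge0 gN) mul0r powR0.
- move=> s x s0; rewrite (gaugeZ gg)// (gaugeZ gN)//
  invfM mulrACA divff ?mul1r//.
  by rewrite gt_eqF.
Qed.

End sphere_integral.

(** * Bounds on dual quermassintegrals from inclusions *)

Section dual_quermassintegral_bounds.
Context {R : realType} (n : nat).
Local Notation leb := (@lebesgue_rV R).
Implicit Types (g : 'rV[R]_n.+1 -> R) (K : set 'rV[R]_n.+1).

(** For q > n+1 this is, by [integral_sphere_gauge], the q-th dual quermassintegral of the set
    [g x <= 1], with the value +oo allowed. *)
Definition gauge_mass (q : R) g : \bar R :=
  (\int[leb n.+1]_x ((enorm x / g x) `^ (q - n.+1%:R) * (g x <= 1)%R%:R)%:E)%E.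

Lemma gauge_mass_ge0 q g : (0 <= gauge_mass q g)%E.
Proof. by apply: integral_ge0 => x _; rewrite lee_fin mulr_ge0// powR_ge0. Qed.

Lemma sphere_neq0 (u : 'rV[R]_n.+1) : sphere n.+1 u -> u != 0.
Proof.
rewrite /sphere/= => u1; apply/eqP => u0; move: u1;
  rewrite u0 (gauge0 (gauge_enorm n)).
by move/eqP; rewrite eq_sym oner_eq0.
Qed.

Lemma radial_le g K a u : gauge g -> u != 0 -> 0 <= a ->
  K `<=` [set x | g x <= a] -> radial K u <= a * (g u)^-1.
Proof.
move=> gg u0 a0 Kg; have gu := gauge_gt0 gg u0; rewrite /radial.
(* If the ray misses K, the radial function is the supremum of the empty set, which is 0 by
   convention. *)
have [->|/set0P E0] := eqVneq [set l : R | 0 < l /\ K (l *: u)] set0.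
  by rewrite sup0 mulr_ge0// invr_ge0 ltW.
apply: ge_sup => // l [l0 /Kg/=]; rewrite (gaugeZ gg)// => h.
by rewrite ler_pdivlMr.
Qed.

(** The first inclusion bounds the set of radii: the supremum of an unbounded set is 0 by
    convention, so the second inclusion alone gives no lower bound. *)
Lemma radial_ge g K a c u : gauge g -> u != 0 -> 0 < c ->
  K `<=` [set x | g x <= a] -> [set x | g x <= c] `<=` K ->
  c * (g u)^-1 <= radial K u.
Proof.
move=> gg u0 c0 Kg gK; have gu := gauge_gt0 gg u0.
apply: ub_le_sup.
  exists (a / g u) => l [l0 /Kg/=]; rewrite (gaugeZ gg)// => h.
  by rewrite ler_pdivlMr.
have cg : 0 < c / g u by rewrite divr_gt0.
by split => //; apply: gK => /=; rewrite (gaugeZ gg)// divfK// gt_eqF.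
Qed.

Lemma integral_sphere_gaugeZ g (q c : R) : gauge g -> n.+1%:R < q -> 0 <= c ->
  (\int[sphere_measure n.+1]_(u in sphere n.+1) ((c * (g u)^-1) `^ q)%:E =
   n.+1%:R%:E * ((c `^ q)%:E * gauge_mass q g))%E.
Proof.
move=> gg nq c0; rewrite muleCA -(integral_sphere_gauge gg nq).
rewrite -ge0_integralZl_EFin//; last 4 first.
- exact: measurable_sphere.
- by move=> x _; rewrite lee_fin powR_ge0.
- apply/measurable_EFinP; apply: measurable_funTS; apply: measurable_fun_powR.
  apply: measurable_fun_inv => [x|];
    [exact: gauge_ge0 | exact: gauge_measurable].
- exact: powR_ge0.
apply: eq_integral => u _; rewrite -EFinM powRM// invr_ge0.
exact: gauge_ge0.
Qed.

Lemma radial_ge0 K u : 0 <= radial K u.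
Proof.
rewrite /radial; have [[[l [l0 Kl]] E]|/sup_out->//] :=
  pselect (has_sup [set l : R | 0 < l /\ K (l *: u)]).
by rewrite (le_trans (ltW l0))//; exact: ub_le_sup.
Qed.

Lemma integral_radial_le g (q a : R) K : gauge g -> n.+1%:R < q -> 0 <= a ->
  (gauge_mass q g < +oo)%E -> K `<=` [set x | g x <= a] ->
  (\int[sphere_measure n.+1]_(u in sphere n.+1) (radial K u `^ q)%:E <=
    (n.+1%:R * (a `^ q * fine (gauge_mass q g)))%:E)%E.
Proof.
move=> gg nq a0 goo Kg.
have q0 : 0 <= q by rewrite (le_trans _ (ltW nq)).
rewrite !EFinM fineK; last by rewrite ge0_fin_numE// gauge_mass_ge0.
rewrite -integral_sphere_gaugeZ//; apply: ge0_le_integral_nonmeasurable.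
  by move=> u _; rewrite lee_fin powR_ge0.
move=> u /sphere_neq0 u0; have gu := gauge_gt0 gg u0; rewrite lee_fin.
apply: ge0_ler_powR; rewrite ?nnegrE ?radial_ge0 ?divr_ge0 ?(ltW gu)//.
exact: radial_le.
Qed.

Lemma dual_quermassintegral_le g (q a : R) K : gauge g -> n.+1%:R < q ->
  0 <= a ->
  (gauge_mass q g < +oo)%E -> K `<=` [set x | g x <= a] ->
  dual_quermassintegral q K <= a `^ q * fine (gauge_mass q g).
Proof.
move=> gg nq a0 goo Kg; have KX := integral_radial_le gg nq a0 goo Kg.
rewrite /dual_quermassintegral ler_pdivrMl ?ltr0n// /Rintegral.
rewrite -[leRHS]/(fine (_%:E)); apply: fine_le => //.
rewrite ge0_fin_numE; last first.
  by apply: integral_ge0 => u _; rewrite lee_fin powR_ge0.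
by rewrite (le_lt_trans KX)// ltry.
Qed.

Lemma dual_quermassintegral_ge g (q c : R) K : gauge g -> n.+1%:R < q ->
  0 < c ->
  (gauge_mass q g < +oo)%E ->
  K `<=` [set x | g x <= 1] -> [set x | g x <= c] `<=` K ->
  c `^ q * fine (gauge_mass q g) <= dual_quermassintegral q K.
Proof.
move=> gg nq c0 goo Kg gK.
have q0 : 0 <= q by rewrite (le_trans _ (ltW nq)).
(* The upper inclusion makes the spherical integral finite; otherwise [fine] would send +oo to 0 and
   spoil the lower bound. *)
have KX := integral_radial_le gg nq ler01 goo Kg.
rewrite /dual_quermassintegral ler_pdivlMl ?ltr0n// /Rintegral.
rewrite -[leLHS]/(fine (_%:E)); apply: fine_le => //.
  rewrite ge0_fin_numE; last first.
    by apply: integral_ge0 => u _; rewrite lee_fin powR_ge0.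
  by rewrite (le_lt_trans KX)// ltry.
rewrite !EFinM fineK; last by rewrite ge0_fin_numE// gauge_mass_ge0.
rewrite -(integral_sphere_gaugeZ gg nq (ltW c0));
  apply: ge0_le_integral_nonmeasurable.
  by move=> u _; rewrite lee_fin powR_ge0.
move=> u /sphere_neq0 u0; have gu := gauge_gt0 gg u0; rewrite lee_fin.
apply: ge0_ler_powR; rewrite ?nnegrE ?radial_ge0 ?divr_ge0 ?(ltW gu)
  ?(ltW c0)//.
exact: (radial_ge gg u0 c0 Kg gK).
Qed.

End dual_quermassintegral_bounds.

Lemma powR_midpoint (R: realType) (a b k : R) : 0<=a -> 0<=b -> 1<=k ->
  2 * ((a+b)/2) `^ k <= a `^ k + b `^ k.
Proof.
move=> a0 b0 k1.
have h0 : 0 <= 2^-1 :> R by rewrite invr_ge0.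
have h1 : 2^-1 <= 1 :> R by lra.
have : (2^-1 * a + unstable.onem (2^-1) * b) `^ k <=
    2^-1 * a `^ k + unstable.onem (2^-1) * b `^ k.
  by apply: (@convex_powR R k k1 (Itv01 h0 h1) a b);
    rewrite inE/= in_itv/= andbT.
have -> : @unstable.onem R 2^-1 = 2^-1 by rewrite /unstable.onem; lra.
have -> : (a + b) / 2 = 2^-1 * a + 2^-1 * b by lra.
by lra.
Qed.

(** * Boxes and the substitution that carries them to the cube *)

Section box_gauge.
Context {R : realType} (n : nat).
Implicit Types d x y : 'rV[R]_n.+1.

Definition boxgauge d x : R := \big[Num.max/0]_i (`|x 0 i| / d 0 i).

Lemma boxgauge_leP d x a : (forall i, 0 < d 0 i) -> 0 <= a ->
  reflect (forall i, `|x 0 i| <= a * d 0 i) (boxgauge d x <= a).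
Proof.
move=> d0 a0; apply: (iffP (bigmax_leP _ _ _ _)).
  by move=> [_ h] i; have := h i isT; rewrite ler_pdivrMr.
by move=> h; split => // i _; rewrite ler_pdivrMr.
Qed.

Lemma boxgauge_ge0 d x : 0 <= boxgauge d x.
Proof. exact: bigmax_ge_id. Qed.

Lemma measurable_boxgauge d : measurable_fun setT (boxgauge d).
Proof.
rewrite /boxgauge; elim: (index_enum _) => [|i s IH].
  by under eq_fun do rewrite big_nil; exact: measurable_cst.
under eq_fun do rewrite big_cons; apply: measurable_maxr => //.
apply: measurable_funM; last exact: measurable_cst.
apply: measurableT_comp; [exact: normr_measurable | exact: measurable_coord].
Qed.

Lemma gauge_boxgauge d : (forall i, 0 < d 0 i) -> gauge (boxgauge d).
Proof.
move=> d0; split; first exact: measurable_boxgauge.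
  move=> x x0; rewrite lt_neqAle boxgauge_ge0 andbT eq_sym; apply: contra x0.
  move=> /eqP e; apply/eqP/rowP => i; rewrite mxE; apply/eqP.
  have /(boxgauge_leP x d0 (lexx 0))/(_ i) : boxgauge d x <= 0 by rewrite e.
  by rewrite mul0r normr_le0.
move=> s x s0; rewrite /boxgauge.
rewrite (_ : \big[_/_]_i _ = \big[Num.max/0]_i (s * (`|x 0 i| / d 0 i)));
  last first.
  by apply: eq_bigr => i _; rewrite mxE normrM gtr0_norm// mulrA.
elim/big_ind2 : _ => //; first by rewrite mulr0.
by move=> a1 b1 a2 b2 -> ->; rewrite maxr_pMr// ltW.
Qed.

Lemma boxgauge_rowmul d y : (forall i, 0 < d 0 i) ->
  boxgauge d (rowmul d y) = boxgauge (const_mx 1) y.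
Proof.
move=> d0; apply: eq_bigr => i _; rewrite !mxE divr1 normrM gtr0_norm//.
by rewrite mulrC mulKf// gt_eqF.
Qed.

Lemma enorm_rowmul d y : enorm (rowmul d y) = Num.sqrt (\sum_i d 0 i ^+ 2 * y 0
  i ^+ 2).
Proof. by congr Num.sqrt; apply: eq_bigr => i _; rewrite mxE exprMn. Qed.

(** [boxgauge (const_mx 1)] is the sup norm, so this is |y|_oo^(-p) cut off to the cube: the factor
    of the integrand that does not depend on the box. *)
Definition cube_weight (p : R) y : R :=
  (boxgauge (const_mx 1) y)^-1 `^ p * (boxgauge (const_mx 1) y <= 1)%R%:R.

Lemma const1_gt0 i : 0 < (const_mx 1 : 'rV[R]_n.+1) 0 i.
Proof. by rewrite mxE. Qed.

Lemma cube_weight_ge0 p y : 0 <= cube_weight p y.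
Proof. by rewrite mulr_ge0// powR_ge0. Qed.

Lemma measurable_cube_weight p : measurable_fun setT (cube_weight p).
Proof.
have mb := measurable_boxgauge (const_mx 1).
have mi : measurable_fun setT (fun y => (boxgauge (const_mx 1) y)^-1).
  by apply: measurable_fun_inv => // y; exact: boxgauge_ge0.
by rewrite /cube_weight; meas.
Qed.

Lemma gauge_mass_boxgauge (q : R) d : (forall i, 0 < d 0 i) ->
  (gauge_mass q (boxgauge d) = (\prod_i d 0 i)%:E *
   \int[lebesgue_rV n.+1]_y
     ((\sum_i d 0 i ^+ 2 * y 0 i ^+ 2) `^ ((q - n.+1%:R) / 2) *
      cube_weight (q - n.+1%:R) y)%:E)%E.
Proof.
move=> d0; rewrite /gauge_mass; have gd := gauge_boxgauge d0.
have mg := gauge_measurable gd;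
  have mN := gauge_measurable (gauge_enorm (R:=R) n).
have mi : measurable_fun setT (fun y => (boxgauge d y)^-1).
  by apply: measurable_fun_inv => // y; exact: boxgauge_ge0.
rewrite (ge0_integral_rowmul d0); last 2 first.
- by apply/measurable_EFinP; meas.
- by move=> x; rewrite lee_fin mulr_ge0// powR_ge0.
congr (_ * _)%E; apply: eq_integral => y _; congr (_%:E).
rewrite boxgauge_rowmul// /cube_weight mulrA; congr (_ * _).
rewrite powRM ?invr_ge0 ?boxgauge_ge0 ?sqrtr_ge0//; congr (_ * _).
rewrite enorm_rowmul -powR12_sqrt; last first.
  by apply: sumr_ge0 => i _; rewrite mulr_ge0// sqr_ge0.
by rewrite -powRrM mulrC.
Qed.

Lemma lebesgue_rV_box m (l u : 'I_m -> R) : (forall i, l i <= u i) ->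
  lebesgue_rV m [set x : 'rV[R]_m | forall i, l i <= x 0 i <= u i] =
  (\prod_i (u i - l i))%:E.
Proof.
elim: m l u => [|m IH] l u lu.
  rewrite big_ord0 (_ : [set _ | _] = setT); last by apply/seteqP;
    split => // x _ [].
  by rewrite /= diracE in_setT.
pose A : set (measurableTypeR R) := `[l ord0, u ord0]%classic.
pose B := [set x : 'rV[R]_m | forall i,
  l (lift ord0 i) <= x 0 i <= u (lift ord0 i)].
have mB : measurable B.
  rewrite (_ : B = \big[setI/setT]_(i < m) ((fun x : 'rV[R]_m => x 0 i) @^-1`
    `[l (lift ord0 i), u (lift ord0 i)])).
    apply: bigsetI_measurable => i _; rewrite -[X in measurable X]setTI.
    by apply: measurable_coord.
  rewrite -bigcap_seq; apply/seteqP; split => x.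
    by move=> Bx i _ /=; rewrite in_itv/= Bx.
  by move=> h i; have := h i (mem_index_enum i); rewrite /= in_itv.
transitivity ((@lebesgue_measure R \x lebesgue_rV m) (A `*` B))%E.
  rewrite /= /mcons /pushforward; congr (_ _); apply/seteqP; split => -[a y]/=.
    move=> h; split => /=; first by rewrite /A/= in_itv/=; have := h ord0;
      rewrite consrV0.
    by move=> i; have := h (lift ord0 i); rewrite consrVS.
  move=> [/= Aa By] i; case: (unliftP ord0 i) => [j|] ->.
    by rewrite consrVS; exact: By.
  by rewrite consrV0; move: Aa; rewrite /A/= in_itv.
rewrite product_measure1E//; last exact: measurable_itv.
rewrite IH; last by move=> i; exact: lu.
rewrite /A/= lebesgue_measure_itv/= lte_fin big_ord_recl EFinM; congr (_ * _)%E.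
have := lu ord0; rewrite le_eqVlt => /predU1P[->|->]; last by rewrite EFinB.
by rewrite ltxx subrr.
Qed.

End box_gauge.

(** * Moments of diagonal quadratic forms over the cube *)

Section cube_moment.
Context {R : realType} (n : nat).
Implicit Types (y : 'rV[R]_n.+2) (a b c p t : R).
Local Notation leb := (@lebesgue_rV R n.+2).
Local Notation i0 := (ord0 : 'I_n.+2).
Local Notation i1 := (lift ord0 ord0 : 'I_n.+2).
Local Notation tl i := (lift ord0 (lift ord0 i) : 'I_n.+2).

Definition diagform a b c y : R :=
  a * y 0 i0 ^+ 2 + b * y 0 i1 ^+ 2 + c * \sum_i y 0 (tl i) ^+ 2.

(** The parameters stand for squared half-sides: [gauge_mass_boxvec] expresses V of the box (a, b,
    c, ..., c) through this integral at a^2, b^2, c^2. *)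
Definition cube_moment p a b c : \bar R :=
  (\int[leb]_y (diagform a b c y `^ (p / 2) * cube_weight p y)%:E)%E.

Definition boxvec a b c : 'rV[R]_n.+2 := consrV (a, consrV (b, const_mx c)).

Lemma boxvec0 a b c : boxvec a b c 0 i0 = a. Proof. by rewrite /boxvec consrV0.
  Qed.
Lemma boxvec1 a b c : boxvec a b c 0 i1 = b.
Proof. by rewrite /boxvec consrVS consrV0. Qed.
Lemma boxvecS a b c i : boxvec a b c 0 (tl i) = c.
Proof. by rewrite /boxvec !consrVS/= mxE. Qed.

Lemma boxvec_gt0 a b c i : 0 < a -> 0 < b -> 0 < c -> 0 < boxvec a b c 0 i.
Proof.
move=> a0 b0 c0; case: (unliftP ord0 i) => [j|] ->; last by rewrite boxvec0.
by case: (unliftP ord0 j) => [k|] ->; rewrite ?boxvec1// boxvecS.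
Qed.

Lemma gauge_mass_boxvec (q : R) a b c : 0 < a -> 0 < b -> 0 < c ->
  gauge_mass q (boxgauge (boxvec a b c)) =
  ((a * b * c ^+ n)%:E * cube_moment (q - n.+2%:R) (a ^+ 2) (b ^+ 2) (c ^+
    2))%E.
Proof.
move=> a0 b0 c0; rewrite gauge_mass_boxgauge; last by move=> i;
  exact: boxvec_gt0.
congr (_%:E * _)%E.
  rewrite !big_ord_recl boxvec0 boxvec1 mulrA; congr (_ * _).
  by under eq_bigr do rewrite boxvecS; rewrite prodr_const card_ord.
apply: eq_integral => y _; congr ((_ `^ _ * _)%:E).
rewrite !big_ord_recl boxvec0 boxvec1 /diagform -addrA; congr (_ + (_ + _)).
by rewrite mulr_sumr; apply: eq_bigr => i _; rewrite boxvecS.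
Qed.

Lemma measurable_diagform a b c : measurable_fun setT (diagform a b c).
Proof.
have mc := fun i : 'I_n.+2 => @measurable_coord R n.+2 i.
rewrite /diagform; apply: measurable_funD; first apply: measurable_funD.
- by apply: measurable_funM; [exact: measurable_cst | apply: measurable_funX;
  exact: mc].
- by apply: measurable_funM; [exact: measurable_cst | apply: measurable_funX;
  exact: mc].
- apply: measurable_funM; first exact: measurable_cst.
  by apply: measurable_sum => i; apply: measurable_funX; exact: mc.
Qed.

Lemma diagform_ge0 a b c y : 0 <= a -> 0 <= b -> 0 <= c ->
  0 <= diagform a b c y.
Proof.
move=> a0 b0 c0; rewrite /diagform; apply: addr_ge0.
  by rewrite addr_ge0// mulr_ge0// sqr_ge0.
by apply: mulr_ge0 => //; apply: sumr_ge0 => i _; exact: sqr_ge0.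
Qed.

Let moment_ge0 p a b c y : 0 <= diagform a b c y `^ (p / 2) * cube_weight p y.
Proof. by rewrite mulr_ge0 ?powR_ge0 ?cube_weight_ge0. Qed.

Let measurable_moment p a b c :
  measurable_fun setT (fun y => diagform a b c y `^ (p / 2) * cube_weight p y).
Proof.
have := measurable_diagform a b c; have := @measurable_cube_weight R n.+1 p.
by move=> ? ?; meas.
Qed.

Let mE p a b c : measurable_fun setT
  (fun y => (diagform a b c y `^ (p / 2) * cube_weight p y)%:E).
Proof. by apply/measurable_EFinP; exact: measurable_moment. Qed.

Let pE p a b c y : setT y ->
  (0 <= (diagform a b c y `^ (p / 2) * cube_weight p y)%:E)%E.
Proof. by move=> _; rewrite lee_fin. Qed.

Lemma cube_moment_ge0 p a b c : (0 <= cube_moment p a b c)%E.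
Proof. by apply: integral_ge0 => y _; rewrite lee_fin. Qed.

Lemma le_cube_moment p a b c a' b' c' : 0 <= p ->
  0 <= a <= a' -> 0 <= b <= b' -> 0 <= c <= c' ->
  (cube_moment p a b c <= cube_moment p a' b' c')%E.
Proof.
move=> p0 /andP[a0 aa] /andP[b0 bb] /andP[c0 cc].
apply: ge0_le_integral_nonmeasurable => y _; rewrite lee_fin ?moment_ge0//.
apply: ler_wpM2r; first exact: cube_weight_ge0.
have a'0 := le_trans a0 aa; have b'0 := le_trans b0 bb;
  have c'0 := le_trans c0 cc.
apply: ge0_ler_powR; rewrite ?nnegrE ?diagform_ge0 ?divr_ge0//.
rewrite /diagform; apply: lerD; first apply: lerD.
- by rewrite ler_wpM2r ?sqr_ge0.
- by rewrite ler_wpM2r ?sqr_ge0.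
- by rewrite ler_wpM2r// sumr_ge0// => i _; exact: sqr_ge0.
Qed.

Lemma cube_momentZ p t a b c : 0 <= t -> 0 <= a -> 0 <= b -> 0 <= c ->
  cube_moment p (t * a) (t * b) (t * c) = ((t `^ (p / 2))%:E * cube_moment p a
    b c)%E.
Proof.
move=> t0 a0 b0 c0; rewrite /cube_moment -(ge0_integralZl_EFin _ measurableT
  (@pE p a b c) (@mE p a b c) (powR_ge0 _ _)).
apply: eq_integral => y _; rewrite -EFinM [in RHS]mulrA -powRM ?diagform_ge0//.
by congr ((_ `^ _ * _)%:E); rewrite /diagform; ring.
Qed.

Lemma cube_weight_rowswap p y : cube_weight p (rowswap y) = cube_weight p y.
Proof.
suff E : boxgauge (const_mx 1) (rowswap y) = boxgauge (const_mx 1) y.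
  by rewrite /cube_weight E.
rewrite /boxgauge [RHS](reindex_inj (@perm_inj _ (tperm i0 i1))).
by apply: eq_bigr => i _; rewrite !mxE.
Qed.

Lemma diagform_rowswap a b c y : diagform a b c (rowswap y) = diagform b a c y.
Proof.
rewrite /diagform !mxE tpermL tpermR [X in X + _ = _]addrC; congr (_ + _ * _).
by apply: eq_bigr => i _; rewrite !mxE tpermD.
Qed.

Lemma cube_momentC p a b c : cube_moment p a b c = cube_moment p b a c.
Proof.
rewrite /cube_moment -(ge0_integral_rowswap (@mE p a b c) (fun y => @pE p a b c
  y I)).
by apply: eq_integral => y _; rewrite diagform_rowswap cube_weight_rowswap.
Qed.

(** By symmetry the right-hand side is the mean of the moments for (a, b) and (b, a). The midpoint
    form is pointwise the mean of these two forms, and s^(p/2) is convex as p/2 >= 1. *)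
Lemma cube_moment_midpoint p a b c : 2 <= p -> 0 <= a -> 0 <= b -> 0 <= c ->
  (cube_moment p ((a + b) / 2) ((a + b) / 2) c <= cube_moment p a b c)%E.
Proof.
move=> p2 a0 b0 c0; set s := (a + b) / 2.
have s0 : 0 <= s by rewrite divr_ge0// addr_ge0.
rewrite -(@lee_pmul2l _ 2%:E)//.
rewrite [leRHS](_ : _ = cube_moment p a b c + cube_moment p b a c)%E;
  last first.
  by rewrite (cube_momentC p b a) mule_natl mule2n.
rewrite /cube_moment -(ge0_integralD _ measurableT (@pE p a b c) (@mE p a b c)
  (@pE p b a c) (@mE p b a c)).
rewrite -(ge0_integralZl_EFin _ measurableT (@pE p s s c) (@mE p s s c) (ler0n
  R 2)).
apply: ge0_le_integral_nonmeasurable => y _; first by rewrite lee_fin mulr_ge0.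
rewrite -EFinM -EFinD lee_fin mulrA -mulrDl; apply: ler_wpM2r;
  first exact: cube_weight_ge0.
have -> : diagform s s c y = (diagform a b c y + diagform b a c y) / 2.
  by rewrite /diagform /s; field.
apply: powR_midpoint; rewrite ?diagform_ge0//; lra.
Qed.

(** Either u + v <= t u, or v > (t - 1) u and then u + v <= t v / (t - 1). The constant in front of
    u^r can thus be kept as close to 1 as desired. *)
Lemma powRD_le (r u v : R) t : 1 < t -> 0 <= r -> 0 <= u -> 0 <= v ->
  (u + v) `^ r <= t `^ r * u `^ r + (t / (t - 1)) `^ r * v `^ r.
Proof.
move=> t1 r0 u0 v0; have t0 : 0 < t by lra.
have T0 : 0 <= t / (t - 1) by rewrite divr_ge0//; lra.
have [h|h] := leP (u + v) (t * u).
  apply: (@le_trans _ _ (t `^ r * u `^ r));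
    last by rewrite lerDl mulr_ge0 ?powR_ge0.
  rewrite -powRM ?(ltW t0)//.
  by apply: ge0_ler_powR; rewrite ?nnegrE ?addr_ge0 ?mulr_ge0 ?(ltW t0).
apply: (@le_trans _ _ ((t / (t - 1)) `^ r * v `^ r));
  last by rewrite lerDr mulr_ge0 ?powR_ge0.
rewrite -powRM//; apply: ge0_ler_powR => //.
- by rewrite nnegrE addr_ge0.
- by rewrite nnegrE mulr_ge0.
- by rewrite mulrAC ler_pdivlMr; [nra | lra].
Qed.

(** A quantitative form of the limit c -> 0: the last term is of order c^(p/2) by homogeneity, and t
    may be taken close to 1. *)
Lemma cube_moment_split p t a b c : 0 <= p -> 1 < t -> 0 <= a -> 0 <= b ->
  0 <= c ->
  (cube_moment p a b c <= (t `^ (p / 2))%:E * cube_moment p a b 0 +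
     ((t / (t - 1)) `^ (p / 2))%:E * cube_moment p 0 0 c)%E.
Proof.
move=> p0 t1 a0 b0 c0; rewrite /cube_moment.
rewrite -(ge0_integralZl_EFin _ measurableT (@pE p a b 0) (@mE p a b 0)
  (powR_ge0 _ _)).
rewrite -(ge0_integralZl_EFin _ measurableT (@pE p 0 0 c) (@mE p 0 0 c)
  (powR_ge0 _ _)).
have pM (s a' b' c' : R) y : setT y ->
    (0 <= (s `^ (p / 2))%:E * (diagform a' b' c' y `^ (p / 2) * cube_weight p
      y)%:E)%E.
  by move=> _; rewrite -EFinM lee_fin mulr_ge0 ?powR_ge0.
have mM (s a' b' c' : R) : measurable_fun setT (fun y =>
    (s `^ (p / 2))%:E * (diagform a' b' c' y `^ (p / 2) * cube_weight p
      y)%:E)%E.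
  by apply/measurable_EFinP; apply: measurable_funM => //;
    exact: measurable_cst.
rewrite -(ge0_integralD _ measurableT (pM _ _ _ _) (mM _ _ _ _) (pM _ _ _ _)
  (mM _ _ _ _)).
apply: ge0_le_integral_nonmeasurable => y _; first by rewrite lee_fin.
rewrite -!EFinM -EFinD lee_fin;
  move: (cube_weight p y) (cube_weight_ge0 p y) => w w0.
rewrite !mulrA -mulrDl; apply: ler_wpM2r => //.
have -> : diagform a b c y = diagform a b 0 y + diagform 0 0 c y.
  by rewrite /diagform; ring.
by apply: powRD_le; rewrite ?diagform_ge0 ?divr_ge0.
Qed.

(** The form is at most C |y|_oo^2, so its power p/2 is absorbed by the weight and a constant on the
    cube remains. *)
Lemma cube_moment_fin p a b c : 0 < p -> 0 <= a -> 0 <= b -> 0 <= c ->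
  (cube_moment p a b c < +oo)%E.
Proof.
move=> p0 a0 b0 c0; pose g := @boxgauge R n.+1 (const_mx 1).
have g0 y : 0 <= g y by exact: boxgauge_ge0.
pose C := a + b + c * n%:R.
have C0 : 0 <= C by rewrite !addr_ge0// mulr_ge0.
have sq i y : y 0 i ^+ 2 <= g y ^+ 2.
  rewrite -[y 0 i ^+ 2]real_normK ?num_real// ler_sqr ?nnegrE//.
  by have /(boxgauge_leP _ (@const1_gt0 R _) (g0 y))/(_ i) := lexx (g y);
    rewrite mxE mulr1.
have le_form y : diagform a b c y <= C * g y ^+ 2.
  rewrite /C !mulrDl /diagform; apply: lerD; first by apply: lerD;
    rewrite ler_wpM2l.
  rewrite -mulrA ler_wpM2l// (le_trans (ler_sum _ (fun i _ => sq _ _)))//.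
  by rewrite sumr_const card_ord mulr_natl.
pose B := [set y : 'rV[R]_n.+2 | forall i, -1 <= y 0 i <= 1].
have BE y : B y <-> g y <= 1.
  split => [By|/(boxgauge_leP _ (@const1_gt0 R _) ler01) h i].
    by apply/(boxgauge_leP _ (@const1_gt0 R _) ler01) => i;
      rewrite mxE mulr1 ler_norml By.
  by have := h i; rewrite mxE mulr1 ler_norml.
have mB : measurable B.
  rewrite (_ : B = g @^-1` `]-oo, 1]%classic); last first.
    by apply/seteqP; split => y /=; rewrite in_itv/= => /BE.
  by rewrite -[X in measurable X]setTI; apply: measurable_boxgauge.
apply: (@le_lt_trans _ _ (\int[leb]_y ((C `^ (p / 2))%:E * (\1_B y)%:E))%E).
  apply: ge0_le_integral_nonmeasurable => y _; first by rewrite lee_fin.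
  rewrite -EFinM lee_fin /cube_weight mulrA indicE.
  have -> : (y \in B) = (g y <= 1) by apply/idP/idP; rewrite inE => /BE.
  apply: ler_wpM2r => //.
  apply: (@le_trans _ _ ((C * g y ^+ 2) `^ (p / 2) * (g y)^-1 `^ p)).
    apply: ler_wpM2r; first exact: powR_ge0.
    apply: ge0_ler_powR; rewrite ?nnegrE ?diagform_ge0 ?divr_ge0 ?mulr_ge0
      ?sqr_ge0// ltW//.
  rewrite powRM ?sqr_ge0// -mulrA ler_piMr ?powR_ge0//.
  have -> : (g y ^+ 2) `^ (p / 2) = g y `^ p.
    by rewrite -powR_mulrn// -powRrM mulrC divfK.
  rewrite -powRM ?invr_ge0//.
  (* At the origin the inverse of 0 is 0, and the product is 0 rather than 1. *)
  have [->|gy] := eqVneq (g y) 0; first by rewrite mul0r powR0 ?gt_eqF.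
  by rewrite divff// powR1.
rewrite ge0_integralZl_EFin ?powR_ge0//; last by apply/measurable_EFinP;
  exact: measurable_indic.
rewrite integral_indic//= setIT (lebesgue_rV_box (l := fun=> -1) (u :=
  fun=> 1)) -?EFinM ?ltry//.
Qed.

(** On the part [B] of the cube with first coordinate at least 1/2, the form is at least a/4 and the
    weight at least 1; [B] has positive volume. *)
Lemma cube_moment_gt0 p a b c : 0 < p -> 0 < a -> 0 <= b -> 0 <= c ->
  (0 < cube_moment p a b c)%E.
Proof.
move=> p0 a0 b0 c0; pose g := @boxgauge R n.+1 (const_mx 1).
pose l (i : 'I_n.+2) : R := if i == i0 then 2^-1 else -1.
pose B := [set y : 'rV[R]_n.+2 | forall i, l i <= y 0 i <= 1].
have l1 i : -1 <= l i <= 2^-1 by rewrite /l; case: ifP => _; lra.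
have mB : measurable B.
  rewrite (_ : B = \big[setI/setT]_i ((fun x : 'rV[R]_n.+2 => x 0 i) @^-1` `[l
    i, 1])).
    apply: bigsetI_measurable => i _; rewrite -[X in measurable X]setTI.
    by apply: measurable_coord.
  rewrite -bigcap_seq; apply/seteqP; split => x.
    by move=> Bx i _ /=; rewrite in_itv/= Bx.
  by move=> h i; have := h i (mem_index_enum i); rewrite /= in_itv.
apply: (@lt_le_trans _ _ (\int[leb]_y (((a / 4) `^ (p / 2))%:E * (\1_B
  y)%:E))%E).
  rewrite ge0_integralZl_EFin ?powR_ge0//; last by apply/measurable_EFinP;
    exact: measurable_indic.
  rewrite integral_indic//= setIT (lebesgue_rV_box (l := l) (u := fun=> 1));
    last first.
    by move=> i; have := l1 i; lra.
  rewrite -EFinM lte_fin mulr_gt0//; first by rewrite powR_gt0// divr_gt0.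
  by apply: prodr_gt0 => i _; have := l1 i; lra.
apply: ge0_le_integral_nonmeasurable => y _;
  rewrite -EFinM lee_fin ?mulr_ge0 ?powR_ge0//.
rewrite indicE; case: (boolP (y \in B)); rewrite ?mulr0// inE => By;
  rewrite mulr1.
have gy1 : g y <= 1.
  apply/(boxgauge_leP _ (@const1_gt0 R _) ler01) => i;
    rewrite mxE mulr1 ler_norml.
  by have := By i; have := l1 i; lra.
have y0 : 2^-1 <= y 0 i0 by have := By i0; rewrite /l eqxx => /andP[].
have gy0 : 0 < g y.
  apply: gauge_gt0; first exact: gauge_boxgauge (@const1_gt0 R _).
  by apply/eqP => yE; move: y0; rewrite yE mxE; lra.
rewrite /cube_weight gy1 mulr1 (@le_trans _ _ (diagform a b c y `^ (p / 2)))//.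
  apply: ge0_ler_powR; rewrite ?nnegrE ?diagform_ge0 ?divr_ge0 ?(ltW a0) ?(ltW
    p0)//.
  rewrite /diagform -addrA; apply: (@le_trans _ _ (a * y 0 i0 ^+ 2)).
    rewrite ler_wpM2l ?(ltW a0)// (_ : 4^-1 = 2^-1 ^+ 2); last by field.
    by rewrite ler_sqr ?nnegrE ?invr_ge0// (le_trans _ y0) ?invr_ge0.
  rewrite lerDl; apply: addr_ge0; first by rewrite mulr_ge0// sqr_ge0.
  by apply: mulr_ge0 => //; apply: sumr_ge0 => i _; exact: sqr_ge0.
rewrite ler_peMr ?powR_ge0// -[leLHS](powRr0 (g y)^-1).
by apply: ler_powR; [rewrite invf_ge1 | exact: ltW].
Qed.

End cube_moment.

(** * Smoothness of separable polynomials *)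

Section separable_polynomial.
Context {R : realType} (n : nat).
Implicit Types (c : R) (p : 'I_n -> {poly R}) (x v : 'rV[R]_n).

Definition seppoly c p x : R := c + \sum_i (p i).[x 0 i].

Lemma continuous_horner_coord (p : {poly R}) i :
  continuous (fun x : 'rV[R]_n => p.[x 0 i]).
Proof.
move=> x; apply: (@continuous_comp _ _ _ (fun y : 'rV[R]_n => y 0 i) (horner
  p)).
  exact: coord_continuous.
exact: continuous_horner.
Qed.

Lemma continuous_seppoly c p : continuous (seppoly c p).
Proof.
have h : continuous (fun y : 'rV[R]_n => \sum_i (p i).[y 0 i]).
  apply: (continuous_big (op := +%R)) => [z|i _]; first exact: add_continuous.
  exact: continuous_horner_coord.
move=> x; exact: (continuousD (@cst_continuous _ _ c x) (h x)).
Qed.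

Lemma is_derive_coord x v i : is_derive x v (fun y : 'rV[R]_n => y 0 i) (v 0 i).
Proof.
have d : differentiable (fun y : 'rV[R]_n => y 0 i) x by exact:
  differentiable_coord.
apply: DeriveDef; first exact: diff_derivable.
have lin : linear (fun y : 'rV[R]_n => y 0 i) by move=> a y z; rewrite !mxE.
pose f : {linear 'rV[R]_n -> R} :=
  HB.pack (fun y : 'rV[R]_n => y 0 i) (GRing.isLinear.Build _ _ _ _ _ lin).
rewrite deriveE// (_ : (fun y : 'rV[R]_n => y 0 i) = f)// diff_lin//.
exact: coord_continuous.
Qed.

Lemma is_derive_horner_coord (p : {poly R}) x v i :
  is_derive x v (fun y : 'rV[R]_n => p.[y 0 i]) (p^`().[x 0 i] * v 0 i).
Proof.
elim/poly_ind: p => [|p c IH].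
  rewrite deriv0 horner0 mul0r.
  rewrite (_ : (fun _ => _) = cst 0); first exact: is_derive_cst.
  by apply/funext => y; rewrite horner0.
rewrite (_ : (fun _ => _) = (fun y : 'rV[R]_n => p.[y 0 i]) * (fun y => y 0 i)
  + cst c); last first.
  by apply/funext => y; rewrite !hornerE.
have h := is_deriveD (is_deriveM IH (is_derive_coord x v i)) (is_derive_cst c x
  v).
apply: is_derive_eq h _.
by rewrite derivD derivM derivX derivC !hornerE/= /GRing.scale/=; ring.
Qed.

Lemma is_derive_seppoly c p x j :
  is_derive x (delta_mx 0 j) (seppoly c p) (p j)^`().[x 0 j].
Proof.
rewrite (_ : seppoly c p = cst c + \sum_i (fun y : 'rV[R]_n => (p i).[y 0 i]));
  last first.
  by apply/funext => y; rewrite /seppoly/= fctE fct_sumE.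
have h := is_deriveD (is_derive_cst c x (delta_mx 0 j))
  (is_derive_sum (fun i => is_derive_horner_coord (p i) x (delta_mx 0 j) i)).
apply: is_derive_eq h _; rewrite add0r (bigD1 j)//= big1 ?addr0 => [|i ij].
  by rewrite mxE !eqxx mulr1.
by rewrite mxE eqxx (negbTE ij) mulr0.
Qed.

(** The class is closed under partial derivatives: the one in direction j keeps the j-th summand
    alone, differentiated. Hence induction on the order, over all [c] and [p] at once. *)
Lemma smooth_seppoly c p : smooth_on setT (seppoly c p).
Proof.
move=> k; elim: k c p => [|k IH] c p; split=> //; try by move=> x _;
  exact: continuous_seppoly.
move=> j; split; first by move=> x _; have [] := is_derive_seppoly c p x j.
rewrite (_ : (fun _ => _) = seppoly 0 (fun i => if i == j then (p j)^`() else
  0)); first exact: IH.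
apply/funext => x; have [_ ->] := is_derive_seppoly c p x j.
rewrite /seppoly add0r (bigD1 j)//= eqxx big1 ?addr0// => i /negbTE ->.
by rewrite horner0.
Qed.

End separable_polynomial.

(** * Convexity of powers with exponent a power of 2 *)

Section power_convexity.
Context {R : realType}.
Implicit Types (x y t : R).

Lemma sqr_convex_gap x y t :
  t * x ^+ 2 + (1 - t) * y ^+ 2 - (t * x + (1 - t) * y) ^+ 2 = t * (1 - t) * (x
    - y) ^+ 2.
Proof. by ring. Qed.

Lemma sqr_convex x y t : 0 <= t <= 1 ->
  (t * x + (1 - t) * y) ^+ 2 <= t * x ^+ 2 + (1 - t) * y ^+ 2.
Proof.
move=> /andP[t0 t1]; rewrite -subr_ge0 sqr_convex_gap.
by apply: mulr_ge0; [apply: mulr_ge0; lra | exact: sqr_ge0].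
Qed.

(** Exponents of the form 2^(j+1) permit repeated squaring: the inductive inequality is between
    nonnegative numbers, so it may be squared, and the square is convex. *)
Lemma pow2_convex j x y t : 0 <= t <= 1 ->
  (t * x + (1 - t) * y) ^+ (2 ^ j.+1) <= t * x ^+ (2 ^ j.+1) + (1 - t) * y ^+
    (2 ^ j.+1).
Proof.
move=> t01; elim: j => [|j IH].
  by rewrite expn1 sqr_convex.
rewrite expnSr !exprM; set a := x ^+ _ in IH *; set b := y ^+ _ in IH *.
have e0 : 0 <= (t * x + (1 - t) * y) ^+ (2 ^ j.+1) by rewrite exprn_even_ge0//
  oddX.
apply: (@le_trans _ _ ((t * a + (1 - t) * b) ^+ 2)).
  by rewrite ler_sqr ?nnegrE// (le_trans e0).
exact: sqr_convex.
Qed.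

Lemma pow2_strictly_convex j x y t : x != y -> 0 < t < 1 ->
  (t * x + (1 - t) * y) ^+ (2 ^ j.+1) < t * x ^+ (2 ^ j.+1) + (1 - t) * y ^+ (2
    ^ j.+1).
Proof.
move=> xy /andP[t0 t1]; elim: j => [|j IH].
  rewrite expn1 -subr_gt0 sqr_convex_gap.
  apply: mulr_gt0; first by apply: mulr_gt0; lra.
  by rewrite exprn_even_gt0//= subr_eq0.
rewrite expnSr !exprM; set a := x ^+ _ in IH *; set b := y ^+ _ in IH *.
have e0 : 0 <= (t * x + (1 - t) * y) ^+ (2 ^ j.+1) by rewrite exprn_even_ge0//
  oddX.
apply: (@lt_le_trans _ _ ((t * a + (1 - t) * b) ^+ 2)).
  by rewrite ltr_sqr ?nnegrE// (le_trans e0)// ltW.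
by apply: sqr_convex; lra.
Qed.

End power_convexity.

(** * Superellipsoids as smooth strictly convex bodies close to boxes *)

Section superellipsoid.
Context {R : realType} (n j : nat) (d : 'rV[R]_n) (d0 : forall i, 0 < d 0 i).
Implicit Types (x y : 'rV[R]_n).
Local Notation N := (2 ^ j.+1)%N.

Definition superellipsoid_poly : 'rV[R]_n -> R :=
  seppoly (-1) (fun i => (d 0 i)^-1 ^+ N *: 'X^N).

Definition superellipsoid : set 'rV[R]_n :=
  [set x | superellipsoid_poly x <= 0].

Lemma superellipsoid_polyE x :
  superellipsoid_poly x = \sum_i (x 0 i / d 0 i) ^+ N - 1.
Proof.
rewrite /superellipsoid_poly /seppoly addrC; congr (_ - 1).
by apply: eq_bigr => i _; rewrite hornerZ hornerXn -exprMn mulrC.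
Qed.

Let N_even : ~~ odd N. Proof. by rewrite oddX. Qed.

Lemma continuous_superellipsoid_poly : continuous superellipsoid_poly.
Proof. exact: continuous_seppoly. Qed.

Lemma superellipsoid_coord x i : superellipsoid x -> `|x 0 i| <= d 0 i.
Proof.
rewrite /superellipsoid/= superellipsoid_polyE subr_le0 (bigD1 i)//= => h.
have : (x 0 i / d 0 i) ^+ N <= 1.
  by rewrite (le_trans _ h)// lerDl; apply: sumr_ge0 => k _;
    exact: exprn_even_ge0.
rewrite -[X in X <= _]ger0_norm ?exprn_even_ge0// normrX expr_le1 ?expn_gt0//.
by rewrite normrM normfV (gtr0_norm (d0 i)) ler_pdivrMr// mul1r.
Qed.

(** Each of the n summands is at most c^N. Together with [superellipsoid_coord] this puts the body
    between the box with half-sides [d] and its copy scaled by c. *)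
Lemma superellipsoid_box x c : 0 <= c -> n%:R * c ^+ N <= 1 ->
  (forall i, `|x 0 i| <= c * d 0 i) -> superellipsoid x.
Proof.
move=> c0 cN h; rewrite /superellipsoid/= superellipsoid_polyE subr_le0.
apply: le_trans cN; rewrite mulr_natl -[n in leRHS]card_ord -sumr_const.
apply: ler_sum => i _; rewrite -[X in X <= _]ger0_norm ?exprn_even_ge0// normrX.
apply: lerXn2r; rewrite ?nnegrE//.
by rewrite normrM normfV (gtr0_norm (d0 i)) ler_pdivrMr.
Qed.

Lemma superellipsoid_closed : closed superellipsoid.
Proof.
rewrite (_ : superellipsoid = superellipsoid_poly @^-1` [set y | y <= 0])//.
apply: preimage_closed => [x _|];
  [exact: continuous_superellipsoid_poly | exact: closed_le].
Qed.

Lemma superellipsoid_compact : compact superellipsoid.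
Proof.
apply: subclosed_compact superellipsoid_closed
  (@rV_compact _ n (fun i => `[- d 0 i, d 0 i]%classic) _) _.
  by move=> i; exact: segment_compact.
by move=> x Kx i /=; rewrite in_itv/= -ler_norml superellipsoid_coord.
Qed.

Lemma superellipsoid_interior x : superellipsoid_poly x < 0 ->
  superellipsoid° x.
Proof.
move=> fx; have : open [set y | superellipsoid_poly y < 0].
  rewrite (_ : mkset _ = superellipsoid_poly @^-1` [set y | y < 0])//.
  by apply: open_comp => [y _|]; [exact: continuous_superellipsoid_poly |
    exact: open_lt].
move=> oU; have sub : [set y | superellipsoid_poly y < 0] `<=` superellipsoid.
  by move=> y /= /ltW.
by move: sub; rewrite open_subsetE// => /(_ x); exact.
Qed.

Lemma superellipsoid_poly_convex x y t : 0 <= t <= 1 ->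
  superellipsoid_poly (t *: x + (1 - t) *: y) <=
  t * superellipsoid_poly x + (1 - t) * superellipsoid_poly y.
Proof.
move=> t01; rewrite !superellipsoid_polyE !mulrBr !mulr1 addrACA -opprD subrKC.
rewrite lerD2r !mulr_sumr -big_split/=; apply: ler_sum => i _.
by rewrite !mxE mulrDl -!mulrA pow2_convex.
Qed.

Lemma superellipsoid_poly_strictly_convex x y t : x != y -> 0 < t < 1 ->
  superellipsoid_poly (t *: x + (1 - t) *: y) <
  t * superellipsoid_poly x + (1 - t) * superellipsoid_poly y.
Proof.
move=> xy t01; have t01' : 0 <= t <= 1 by move: t01 => /andP[t0 t1]; lra.
have [i xyi] : exists i, x 0 i != y 0 i.
  apply/not_existsP => h; move/eqP: xy; apply; apply/rowP => i.
  by have /negP := h i; rewrite negbK => /eqP.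
rewrite !superellipsoid_polyE !mulrBr !mulr1 addrACA -opprD subrKC.
rewrite ltrD2r !mulr_sumr -big_split/= [ltLHS](bigD1 i)//= [ltRHS](bigD1 i)//=.
apply: ltr_leD.
  rewrite !mxE mulrDl -!mulrA pow2_strictly_convex//.
  have dN0 : d 0 i != 0 by rewrite gt_eqF.
  by apply: contra xyi => /eqP/(divIf dN0)/eqP.
by apply: ler_sum => k _; rewrite !mxE mulrDl -!mulrA pow2_convex.
Qed.

Lemma superellipsoid_convex_body : convex_body superellipsoid.
Proof.
split; first exact: superellipsoid_compact.
  move=> x y t; rewrite !inE /superellipsoid/= => Kx Ky.
  rewrite [X in superellipsoid_poly X](_ : _ = t%:num *: x + (1 - t%:num) *:
    y)//.
  have t01 : 0 <= t%:num <= 1 by apply/andP.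
  apply: (le_trans (superellipsoid_poly_convex x y t01)).
  have /andP[t0 t1] := t01; nra.
exists 0; apply: superellipsoid_interior;
  rewrite superellipsoid_polyE big1 ?add0r ?ltrN10//.
by move=> i _; rewrite mxE mul0r expr0n expn_eq0.
Qed.

Lemma superellipsoid_symmetric : origin_symmetric superellipsoid.
Proof.
have S x : superellipsoid x -> superellipsoid (- x).
  rewrite /superellipsoid/= !superellipsoid_polyE.
  by under [in X in _ -> X]eq_bigr do rewrite mxE mulNr exprNn -signr_odd
    (negbTE N_even) expr0 mul1r.
apply/seteqP; split => [x Kx|x [y Ky <-]]; last exact: S.
by exists (- x); [exact: S | rewrite opprK].
Qed.

Lemma superellipsoid_strictly_convex : strictly_convex superellipsoid.
Proof.
move=> x y t Kx Ky xy t01; apply: superellipsoid_interior.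
apply: (lt_le_trans (superellipsoid_poly_strictly_convex xy t01)).
move: Kx Ky t01; rewrite /superellipsoid/= => Kx Ky /andP[t0 t1]; nra.
Qed.

(** The polynomial itself serves as defining function on the whole space. It vanishes on the
    boundary but equals -1 at the origin, so a boundary point has a coordinate x_i != 0, and the
    i-th partial derivative, a nonzero multiple of x_i^(N-1), is nonzero there. *)
Lemma superellipsoid_smooth_boundary : smooth_boundary superellipsoid.
Proof.
move=> x [Kx Ix]; exists setT, superellipsoid_poly.
have {}Kx : superellipsoid x by have /closure_id -> := superellipsoid_closed.
split; [exact: openT | by [] | exact: smooth_seppoly | | by apply/seteqP;
  split => y //= [] ].
have fx : superellipsoid_poly x = 0.
  by apply/eqP; rewrite eq_le Kx/= leNgt;
    apply/negP => /superellipsoid_interior.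
have [i xi] : exists i, x 0 i != 0.
  apply/not_existsP => h; move: fx;
    rewrite superellipsoid_polyE big1 => [/eqP|i _].
    by rewrite sub0r oppr_eq0 oner_eq0.
  by have /negP := h i; rewrite negbK => /eqP ->; rewrite mul0r expr0n expn_eq0.
exists i; have [_ ->] := is_derive_seppoly (-1) (fun i => (d 0 i)^-1 ^+ N *:
  'X^N) x i.
rewrite derivZ derivXn hornerZ hornerMn hornerXn; apply: mulf_neq0.
  by rewrite expf_neq0// invr_eq0 gt_eqF.
by rewrite -mulr_natr mulf_neq0 ?expf_neq0// pnatr_eq0 expn_eq0.
Qed.

End superellipsoid.

(** * Choice of the parameters *)

Section choice_of_parameters.
Context {R : realType}.
Implicit Types (k q c v l : R).

Lemma powR_lt_root (x y k : R) : 0 < k -> 0 <= x -> 0 <= y ->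
  x < y `^ k^-1 -> x `^ k < y.
Proof.
move=> k0 x0 y0 h; have yE : (y `^ k^-1) `^ k = y.
  by rewrite -powRrM mulVf ?gt_eqF// powRr1.
by rewrite -[ltRHS]yE; apply: gt0_ltr_powR; rewrite ?nnegrE ?powR_ge0.
Qed.

Lemma powR_root_gt (x y k : R) : 0 < k -> 0 <= x -> 0 <= y -> x `^ k < y ->
  x < y `^ k^-1.
Proof.
move=> k0 x0 y0 h; have xE : (x `^ k) `^ k^-1 = x.
  by rewrite -powRrM mulfV ?gt_eqF// powRr1.
by rewrite -[ltLHS]xE; apply: gt0_ltr_powR; rewrite ?nnegrE ?powR_ge0 ?invr_gt0.
Qed.

Lemma exists_gain k : 1 < k ->
  exists2 e : R, 0 < e < 1 & 1 < (1 - e ^+ 2) * (1 + e ^+ 2) `^ k.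
Proof.
(* With s = e^2, the final estimate asks for s < (k - 1) / (k + 1). As e < 1, taking e equal to this
   bound makes e^2 smaller than it. *)
move=> k1; pose e := (k - 1) / (k + 1); exists e.
  by rewrite /e divr_gt0 ?ltr_pdivrMr; lra.
have e0 : 0 < e by rewrite /e divr_gt0; lra.
have e1 : e * (k + 1) = k - 1 by rewrite divfK// gt_eqF//; lra.
have [s0 se] : 0 < e ^+ 2 /\ e ^+ 2 < e by split; nra.
have {}e1 : e ^+ 2 * (k + 1) < k - 1 by nra.
move: (e ^+ 2) s0 e1 se => s s0 e1 se; have s1 : s < 1 by nra.
(* From exp(x) >= 1 + x and ln(1 + s) >= s / (1 + s), the latter being ln(1 - x) <= -x at x = s / (1
   + s). *)
have h : 1 + k * (s / (1 + s)) <= (1 + s) `^ k.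
  rewrite /powR gt_eqF; last lra.
  apply: le_trans (expR_ge1Dx _) _; rewrite ler_expR ler_wpM2l; [by []|lra|].
  rewrite -lerN2 -lnV ?posrE; last lra.
  rewrite [X in ln X](_ : _ = 1 + - (s / (1 + s))); last by field; lra.
  by apply: le_ln1Dx; rewrite ltrN2 ltr_pdivrMr; lra.
apply: (lt_le_trans _ (ler_wpM2l _ h)); last lra.
rewrite -subr_gt0 (_ : _ - 1 = s * (k - 1 - s * (k + 1)) / (1 + s));
  last by field; lra.
by rewrite divr_gt0 ?mulr_gt0//; lra.
Qed.

(** The gap between v and l leaves room for shrinking the boxes by a factor r; r is halfway between
    the ratio of the q-th roots and 1. *)
Lemma exists_scale q v l : 0 < q -> 0 <= v -> v < l ->
  exists2 r, 0 < r < 1 & v `^ q^-1 < r * l `^ q^-1.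
Proof.
move=> q0 v0 vl; have l0 : 0 < l by exact: le_lt_trans v0 vl.
have h : v `^ q^-1 < l `^ q^-1.
  by apply: gt0_ltr_powR; rewrite ?nnegrE ?invr_gt0// ltW.
have vr0 : 0 <= v `^ q^-1 by exact: powR_ge0.
have lr0 : 0 < l `^ q^-1 by exact: powR_gt0.
have h1 : v `^ q^-1 / l `^ q^-1 < 1 by rewrite ltr_pdivrMr// mul1r.
have h0 : 0 <= v `^ q^-1 / l `^ q^-1 by rewrite divr_ge0// ltW.
exists ((v `^ q^-1 / l `^ q^-1 + 1) / 2); first lra.
by rewrite -ltr_pdivrMr//; lra.
Qed.

Lemma exists_pow2_le n c : 0 <= c < 1 -> exists j, n%:R * c ^+ (2 ^ j.+1) <= 1.
Proof.
move=> /andP[c0 c1].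
have : n%:R * c ^+ i @[i --> \oo] --> (n%:R * 0 : R).
  by apply: cvgM; [exact: cvg_cst | apply: cvg_expr; rewrite ger0_norm].
rewrite mulr0 => /cvgrPdist_le/(_ 1 ltr01)[N _ /(_ N (leqnn _))].
rewrite /= sub0r normrN ger0_norm ?mulr_ge0 ?exprn_ge0// => h.
(* Powers of c decrease with the exponent, and N <= 2^(N+1). *)
exists N; apply: le_trans h; rewrite ler_wpM2l// ler_wiXn2l// ?ltW//.
exact: ltnW (ltn_trans (ltnSn N) (ltn_expl _ _)).
Qed.

End choice_of_parameters.

(** * Comparison of two boxes with their midpoint box *)

Section box_comparison.
Context {R : realType} (n : nat).
Context (q : R) (hq : n.+2%:R + 2 < q).
Local Notation mass a b c := (gauge_mass q (boxgauge (@boxvec R n a b c))).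

Lemma boxgauge_mass_fin a b c : 0 < a -> 0 < b -> 0 < c -> (mass a b c < +oo)%E.
Proof.
move=> a0 b0 c0; rewrite gauge_mass_boxvec//.
have p0 : 0 < q - n.+2%:R by rewrite subr_gt0 (le_lt_trans _ hq)// lerDl.
have : (cube_moment n (q - n.+2%:R) (a ^+ 2) (b ^+ 2) (c ^+ 2) < +oo)%E.
  by apply: cube_moment_fin; rewrite ?sqr_ge0.
have := cube_moment_ge0 n (q - n.+2%:R) (a ^+ 2) (b ^+ 2) (c ^+ 2).
by case: cube_moment => // r _ _; rewrite -EFinM ltry.
Qed.

Lemma exists_box : exists e c l : R, [/\ 0 < e < 1, 0 < c,
  fine (mass 1 1 c) < l, l <= fine (mass (1 + e) (1 - e) c)
  & l <= fine (mass (1 - e) (1 + e) c)].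
Proof.
pose p := q - n.+2%:R; pose k := p / 2.
have p2 : 2 < p by rewrite /p ltrBrDl.
have p0 : 0 < p by lra.
have k1 : 1 < k by rewrite /k; lra.
have k0 : 0 < k by lra.
have [e e01 ] := exists_gain k1; set g := (X in 1 < X) => g1.
have g0 : 0 < g by lra.
(* Halfway between 1 and the k-th root of g, so that t^k < g leaves the room [A] used below. *)
pose t := (1 + g `^ k^-1) / 2.
have rg : 1 < g `^ k^-1 by apply: powR_root_gt; rewrite ?powR1//; lra.
have t1 : 1 < t by rewrite /t; lra.
have tg : t `^ k < g by apply: powR_lt_root; rewrite /t; lra.
(* The moments are finite for nonnegative parameters; [m] is their real value. *)
have [m mE] : exists m : R -> R -> R -> R, forall a b c,
    0 <= a -> 0 <= b -> 0 <= c -> cube_moment n p a b c = (m a b c)%:E.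
  exists (fun a b c => fine (cube_moment n p a b c)) => a b c a0 b0 c0.
  rewrite fineK// ge0_fin_numE; last exact: cube_moment_ge0.
  exact: cube_moment_fin.
have massE a b c : 0 < a -> 0 < b -> 0 < c ->
    fine (mass a b c) = a * b * c ^+ n * m (a ^+ 2) (b ^+ 2) (c ^+ 2).
  by move=> a0 b0 c0; rewrite gauge_mass_boxvec// mE ?sqr_ge0.
have mZ r a b c : 0 <= r -> 0 <= a -> 0 <= b -> 0 <= c ->
    m (r * a) (r * b) (r * c) = r `^ k * m a b c.
  move=> r0 a0 b0 c0; apply: EFin_inj; rewrite EFinM -!mE ?mulr_ge0//.
  exact: cube_momentZ.
have m_midpoint a b c : 0 <= a -> 0 <= b -> 0 <= c ->
    m ((a + b) / 2) ((a + b) / 2) 0 <= m a b c.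
  move=> a0 b0 c0; have ab0 : 0 <= (a + b) / 2 by lra.
  apply: (@le_trans _ _ (m a b 0)).
    rewrite -lee_fin -(mE _ _ _ ab0 ab0 (lexx 0)) -(mE _ _ _ a0 b0 (lexx 0)).
    by apply: cube_moment_midpoint => //; exact: ltW.
  rewrite -lee_fin -(mE _ _ _ a0 b0 (lexx 0)) -(mE _ _ _ a0 b0 c0).
  by apply: le_cube_moment; rewrite ?lexx ?a0 ?b0 ?c0// ltW.
have m_split c : 0 <= c ->
    m 1 1 c <= t `^ k * m 1 1 0 + (t / (t - 1)) `^ k * m 0 0 c.
  move=> c0; rewrite -lee_fin EFinD !EFinM -!mE//.
  by apply: cube_moment_split => //; exact: ltW.
have m0 a b c : 0 <= a -> 0 <= b -> 0 <= c -> 0 <= m a b c.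
  by move=> a0 b0 c0; rewrite -lee_fin -mE//; exact: cube_moment_ge0.
have E0 : 0 < m 1 1 0 by rewrite -lte_fin -mE//; exact: cube_moment_gt0.
pose D := (t / (t - 1)) `^ k * m 0 0 1.
have D0 : 0 <= D by apply: mulr_ge0; [exact: powR_ge0 | exact: m0].
pose A := (g - t `^ k) * m 1 1 0.
have A0 : 0 < A by apply: mulr_gt0 => //; lra.
have AD : 0 < A / (D + 1) by apply: divr_gt0 => //; lra.
(* This s will be c^2. The tail term s^k D = A D / (D + 1) is then below A; dividing by [D + 1] is
   safe although D vanishes in dimension 2. *)
pose s := (A / (D + 1)) `^ k^-1.
have s0 : 0 < s by exact: powR_gt0.
have sk : s `^ k = A / (D + 1).
  by rewrite -powRrM mulVf ?gt_eqF// powRr1// ltW.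
pose c := Num.sqrt s.
have c0 : 0 < c by rewrite sqrtr_gt0.
have cs : c ^+ 2 = s by rewrite sqr_sqrtr// ltW.
have cn : 0 < c ^+ n by exact: exprn_gt0.
have [e0 e1] : 0 < e /\ e < 1 by apply/andP.
exists e, c, (c ^+ n * (g * m 1 1 0)).
(* Taking b = e and b = -e covers the box and its mirror image. The squares of 1 + b and 1 - b have
   mean 1 + e^2, which homogeneity pulls out as (1 + e^2)^k, while the volume factor supplies 1 -
   e^2. *)
have low b : -1 < b < 1 -> b ^+ 2 = e ^+ 2 ->
    c ^+ n * (g * m 1 1 0) <= fine (mass (1 + b) (1 - b) c).
  move=> /andP[b1 b2] be; rewrite massE//; [|lra|lra].
  have := m_midpoint _ _ _ (sqr_ge0 (1 + b)) (sqr_ge0 (1 - b)) (sqr_ge0 c).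
  have -> : ((1 + b) ^+ 2 + (1 - b) ^+ 2) / 2 = (1 + e ^+ 2) * 1.
    by rewrite -be; field.
  rewrite -[X in m _ _ X <= _](mulr0 (1 + e ^+ 2)) mZ// ?addr_ge0 ?sqr_ge0//
    => H.
  rewrite (_ : (1 + b) * (1 - b) * _ = c ^+ n * (1 - e ^+ 2)); last first.
    by rewrite -be; ring.
  rewrite -[leRHS]mulrA; apply: ler_wpM2l; first exact: ltW.
  rewrite /g -mulrA; apply: ler_wpM2l => //; nra.
split => //.
- rewrite massE// !mul1r !expr1n ltr_pM2l// cs.
  apply: (le_lt_trans (m_split _ (ltW s0))).
  have -> : m 0 0 s = s `^ k * m 0 0 1.
    by rewrite -(mZ s 0 0 1) ?mulr0 ?mulr1// ltW.
  rewrite mulrCA -/D sk.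
  suff : A / (D + 1) * D < A by rewrite /A; lra.
  by rewrite mulrAC ltr_pdivrMr; nra.
- by apply: low => //; lra.
- by have := low (- e); rewrite opprK sqrrN; apply => //; lra.
Qed.

End box_comparison.

(** * Passage from boxes to superellipsoids *)

Theorem theorem1p4 (R : realType) (n : nat) (q : R)
    (hn : (2 <= n)%N) (hq : n%:R + 2 < q) :
  exists K L : set 'rV[R]_n,
    [/\ [/\ convex_body K, origin_symmetric K, strictly_convex K
          & smooth_boundary K],
        [/\ convex_body L, origin_symmetric L, strictly_convex L
          & smooth_boundary L]
      & dual_quermassintegral q (minkowski_sum K L) `^ q^-1
        < dual_quermassintegral q K `^ q^-1 + dual_quermassintegral q L `^ q^-1].
Proof.
case: n hn hq => [//|[//|n]] _ {}hq.
have [e [c [l [/andP[e0 e1] c0 ml lp lm]]]] := exists_box hq.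
have nq : n.+2%:R < q by rewrite (le_lt_trans _ hq)// lerDl.
have q0 : 0 < q by rewrite (le_lt_trans _ nq).
have ep : 0 < 1 + e by exact: addr_gt0.
have em : 0 < 1 - e by rewrite subr_gt0.
set v := fine _ in ml.
have v0 : 0 <= v by apply: fine_ge0; exact: gauge_mass_ge0.
have l0 : 0 <= l by exact: le_trans v0 (ltW ml).
have [r /andP[r0 r1] vr] := exists_scale q0 v0 ml.
have r01 : 0 <= r < 1 by rewrite ltW.
(* With this exponent each superellipsoid contains r times its box. *)
have [j nr] := exists_pow2_le n.+2 r01.
pose dp := boxvec n (1 + e) (1 - e) c; pose dm := boxvec n (1 - e) (1 + e) c.
have dp0 i : 0 < dp 0 i by exact: boxvec_gt0.
have dm0 i : 0 < dm 0 i by exact: boxvec_gt0.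
have d0 i : 0 < boxvec n 1 1 c 0 i by exact: boxvec_gt0.
have powRK a x : 0 <= a -> 0 <= x -> (a `^ q * x) `^ q^-1 = a * x `^ q^-1.
  move=> a0 x0; rewrite powRM ?powR_ge0// -powRrM mulfV ?gt_eqF//.
  by rewrite powRr1.
(* Shrinking by r costs a factor r^q in the dual quermassintegral, that is, a factor r after taking
   the q-th root. *)
have lower (d : 'rV[R]_n.+2) : (forall i, 0 < d 0 i) ->
    (gauge_mass q (boxgauge d) < +oo)%E ->
    l <= fine (gauge_mass q (boxgauge d)) ->
    r * l `^ q^-1 <= dual_quermassintegral q (superellipsoid j d) `^ q^-1.
  move=> d0' dfin dl; rewrite -powRK ?(ltW r0)//.
  have H : r `^ q * l <= dual_quermassintegral q (superellipsoid j d).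
    apply: (@le_trans _ _ (r `^ q * fine (gauge_mass q (boxgauge d)))).
      by apply: ler_wpM2l => //; exact: powR_ge0.
    apply: dual_quermassintegral_ge => //; first exact: gauge_boxgauge.
      move=> x Kx; apply/(boxgauge_leP _ d0' ler01) => i; rewrite mul1r.
      exact: (superellipsoid_coord d0' _ Kx).
    move=> x /(boxgauge_leP _ d0' (ltW r0)) h.
    exact: (superellipsoid_box d0' (ltW r0) nr h).
  have rl0 : 0 <= r `^ q * l by apply: mulr_ge0 => //; exact: powR_ge0.
  apply: ge0_ler_powR => //; rewrite ?nnegrE ?invr_ge0 ?(ltW q0)//.
  exact: le_trans rl0 H.
exists (superellipsoid j dp), (superellipsoid j dm); split.
- by split; [exact: superellipsoid_convex_body
    | exact: superellipsoid_symmetric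
    | exact: superellipsoid_strictly_convex
    | exact: superellipsoid_smooth_boundary].
- by split; [exact: superellipsoid_convex_body
    | exact: superellipsoid_symmetric
    | exact: superellipsoid_strictly_convex
    | exact: superellipsoid_smooth_boundary].
set KL := minkowski_sum _ _.
(* The half-sides [dp] and [dm] add up to twice those of the midpoint box, so K + L lies in the
   double of that box. *)
have upper : dual_quermassintegral q KL <= 2 `^ q * v.
  apply: dual_quermassintegral_le => //; first exact: gauge_boxgauge.
    exact: boxgauge_mass_fin.
  move=> _ [x Kx [y Ly <-]]; apply/(boxgauge_leP _ d0 (ler0n R 2)) => i.
  rewrite mxE (le_trans (ler_normD _ _))//.
  have dE : 2 * boxvec n 1 1 c 0 i = dp 0 i + dm 0 i.
    case: (unliftP ord0 i) => [k|] ->; last by rewrite /dp /dm !boxvec0; ring.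
    case: (unliftP ord0 k) => [k'|] ->; last by rewrite /dp /dm !boxvec1; ring.
    by rewrite /dp /dm !boxvecS; ring.
  by rewrite dE lerD// (superellipsoid_coord (j := j)).
have KL0 : 0 <= dual_quermassintegral q KL.
  apply: mulr_ge0; first by rewrite invr_ge0.
  apply: fine_ge0; apply: integral_ge0 => u _.
  by rewrite lee_fin powR_ge0.
apply: (@le_lt_trans _ _ (2 * v `^ q^-1)).
  rewrite -powRK//; apply: ge0_ler_powR => //; rewrite ?nnegrE//.
    by rewrite invr_ge0 ltW.
  exact: le_trans KL0 upper.
have Hp := lower dp dp0 (boxgauge_mass_fin hq ep em c0) lp.
have Hm := lower dm dm0 (boxgauge_mass_fin hq em ep c0) lm.
apply: (lt_le_trans _ (lerD Hp Hm)).
by rewrite mulr_natl mulr2n ltrD.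
Qed.
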